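(* Let $\mathcal F_2$ be the free unital $\ell$-group on two generators. Let $\mathfrak m$ be a maximal ideal of $\mathcal F_2$ lying in the interior of $\mu(\mathcal F_2)$. Write $G_{\mathfrak m}$ for the underlying group of the unital $\ell$-group $\mathcal F_2/\mathfrak m$ (canonically embedded in $\mathbb R$). (i) $G_{\mathfrak m}$ is a subgroup of the additive group $\mathbb R$ of rank $\leq3$ containing $1$. (ii) If $\operatorname{rank}(G_{\mathfrak m})=3$, then for every maximal ideal $\mathfrak n$ of $\mathcal F_2$, $$\mathcal F_2/\mathfrak m\cong\mathcal F_2/\mathfrak n\ \Leftrightarrow\ \mathcal F_2/\mathfrak o(\mathfrak m)\cong\mathcal F_2/\mathfrak o(\mathfrak n).$$ If $\operatorname{rank}(G_{\mathfrak m})=1$, then for every maximal ideal $\mathfrak n$ of $\mathcal F_2$ lying in the interior of $\mu(\mathcal F_2)$, $$\mathcal F_2/\mathfrak m\cong\mathcal F_2/\mathfrak n\ \Leftrightarrow\ \mathcal F_2/\mathfrak o(\mathfrak m)\cong\mathcal F_2/\mathfrak o(\mathfrak n).$$ (iii) If $\operatorname{rank}(G_{\mathfrak m})=2$, let $d$ be the denominator of the smallest positive nonzero rational in $G_{\mathfrak m}$. Then the set of isomorphism classes of unital $\ell$-groups of the form $\mathcal F_2/\mathfrak o(\mathfrak n)$, for $\mathfrak n$ a maximal ideal in the interior of $\mu(\mathcal F_2)$ such that $\mathcal F_2/\mathfrak n\cong\mathcal F_2/\mathfrak m$, contains exactly $\max\left(1,\frac{\phi(d)}{2}\right)$ ele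ments.
   Context: An $\ell$-group is an abelian group with a translation invariant lattice order. A unital $\ell$-group $(G,u)$ is an $\ell$-group $G$ with a distinguished (strong) order unit $u$, i.e., an element whose positive integer multiples eventually dominate any element of $G$. Unital $\ell$-homomorphisms are group homomorphisms that also preserve the lattice structure and the distinguished order unit; $\cong$ denotes unital $\ell$-isomorphism. An ideal of $(G,u)$ is the kernel of a unital $\ell$-homomorphism $\eta$ from $(G,u)$ to a unital $\ell$-group; it is prime if $\eta(G,u)$ is totally ordered. For $\mathfrak m$ a maximal ideal, the germinal ideal $\mathfrak o(\mathfrak m)$ is the intersection of all prime ideals contained in $\mathfrak m$. The set $\mu(G,u)$ of maximal ideals with the hull-kernel topology is the maximal spectral space. By Hölder's theorem, for every maximal ideal $\mathfrak m$ the quotient $(G,u)/\mathfrak m$ is uniquely embeddable as a unital $\ell$-subgroup of the additive group $\mathbb R$ with the usual order and with order unit $1$; $G_{\mathfrak m}$ is regarded as a subgroup of $\mathbb R$ via this embedding. Up to unital $\ell$-isomorphism, the free unital $\ell$-group $\mathcal F_2$ on two generators is the unital $\ell$-group of all continuous piecewise linear functions $f\colon[0,1]^2\to\mathbb R$ (finitely many pieces) such that each piece of $f$ is a linear (affine) polynomial with integer coefficients, with pointwise addition, subtraction, $\max$, $\min$, and with the constant function $1$ as order unit. The map $x\mapsto\mathfrak m_x=\{f\in\mathcal F_2\mid f(x)=0\}$ is a homeomorphism of $[0,1]^2$ onto $\mu(\mathcal F_2)$; a maximal ideal $\mathfrak m_x$ is said to lie in the interior of $\mu(\mathcal F_2)$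 if $x$ lies in the interior $(0,1)^2$ of $[0,1]^2$. $\phi$ is Euler's function. *)

(* Defs.v *)
From HB Require Import structures.
From mathcomp Require Import all_boot all_order all_algebra.
From mathcomp Require Import generic_quotient ring_quotient.
From mathcomp Require Import all_classical all_reals all_analysis.
From mathcomp Require Import ring.

Set Implicit Arguments.
Unset Strict Implicit.
Unset Printing Implicit Defensive.

Import Order.TTheory GRing.Theory Num.Theory.
Import numFieldNormedType.Exports.

Local Open Scope classical_set_scope.
Local Open Scope ring_scope.

(* The lattice operations are fields here, characterized as infimum and
   supremum, because the hierarchy has no join of [zmodType] and
   [latticeType] below [realDomainType]. *)
HB.mixin Record POrderedZmodule_isLGroup T of Num.POrderedZmodule T := {
  lg_meet : T -> T -> T;
  lg_join : T -> T -> T;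
  lg_lexI : forall x y z : T, (x <= lg_meet y z) = (x <= y) && (x <= z);
  lg_leUx : forall x y z : T, (lg_join x y <= z) = (x <= z) && (y <= z);
  lg_leD2l : forall z x y : T, x <= y -> z + x <= z + y
}.

#[short(type="lgroupType")]
HB.structure Definition LGroup :=
  {T of POrderedZmodule_isLGroup T & Num.POrderedZmodule T}.

HB.mixin Record LGroup_hasOrderUnit T of LGroup T := {
  lg_unit : T;
  lg_unitP : forall x : T, exists N, forall n, (N <= n)%N -> x <= lg_unit *+ n
}.

#[short(type="ulgroupType")]
HB.structure Definition UnitalLGroup :=
  {T of LGroup_hasOrderUnit T & LGroup T}.

Definition is_ulhom (G H : ulgroupType) (f : G -> H) : Prop :=
  [/\ {morph f : x y / x + y},
      {morph f : x y / lg_join x y},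
      {morph f : x y / lg_meet x y} &
      f lg_unit = lg_unit].

Definition ul_iso (G H : ulgroupType) : Prop :=
  exists f : G -> H, is_ulhom f /\ bijective f.

(* The isomorphism classes of the unital l-groups F i, for i in D; a class is
   represented by the set of the indices of its members. *)
Definition iso_classes (T : Type) (D : set T) (F : T -> ulgroupType) :
    set (set T) :=
  [set [set j | D j /\ ul_iso (F i) (F j)] | i in D].

Definition hom_kernel (G H : ulgroupType) (f : G -> H) : set G :=
  [set x | f x = 0].

Record ideal (G : ulgroupType) := Ideal {
  ideal_set : set G;
  idealP : exists (H : ulgroupType) (f : G -> H),
    is_ulhom f /\ ideal_set = hom_kernel f
}.

Definition prime_ideal (G : ulgroupType) (I : ideal G) : Prop :=
  exists (H : ulgroupType) (f : G -> H),
    [/\ is_ulhom f, ideal_set I = hom_kernel f &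
        forall x y : G, f x <= f y \/ f y <= f x].

Definition maximal_ideal (G : ulgroupType) (I : ideal G) : Prop :=
  ideal_set I <> setT /\
  forall J : ideal G, ideal_set I `<=` ideal_set J -> ideal_set J <> setT ->
    ideal_set J = ideal_set I.

Definition lg_lattice (G : lgroupType) : Type := G.

HB.instance Definition _ (G : lgroupType) :=
  Order.POrder.copy (lg_lattice G) G.

HB.instance Definition _ (G : lgroupType) :=
  Order.POrder_MeetJoin_isLattice.Build ring_display (lg_lattice G)
    (@lg_lexI G) (@lg_leUx G).

Section LGroupTheory.
Variable G : lgroupType.
Implicit Types x y z : G.

Lemma lg_joinC : commutative (@lg_join G).
Proof. exact: (@joinC _ (lg_lattice G)). Qed.

Lemma lg_joinA : associative (@lg_join G).
Proof. exact: (@joinA _ (lg_lattice G)). Qed.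

Lemma lg_meetC : commutative (@lg_meet G).
Proof. exact: (@meetC _ (lg_lattice G)). Qed.

Lemma lg_meetA : associative (@lg_meet G).
Proof. exact: (@meetA _ (lg_lattice G)). Qed.

Lemma lg_joinKI y x : lg_meet x (lg_join x y) = x.
Proof. exact: (@joinKI _ (lg_lattice G)). Qed.

Lemma lg_meetKU y x : lg_join x (lg_meet x y) = x.
Proof. exact: (@meetKU _ (lg_lattice G)). Qed.

Lemma lg_joinxx x : lg_join x x = x.
Proof. exact: (@joinxx _ (lg_lattice G)). Qed.

Lemma lg_join_r x y : x <= y -> lg_join x y = y.
Proof. exact: (@join_r _ (lg_lattice G)). Qed.

Lemma lg_leUl x y : x <= lg_join x y.
Proof. exact: (@leUl _ (lg_lattice G)). Qed.

Lemma lg_leUr x y : y <= lg_join x y.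
Proof. exact: (@leUr _ (lg_lattice G) y x). Qed.

Lemma lg_addl_join z x y :
  lg_join (z + x) (z + y) = z + lg_join x y.
Proof.
apply/eqP; rewrite eq_le; apply/andP; split.
  by rewrite lg_leUx !lg_leD2l // ?lg_leUl ?lg_leUr.
suff: lg_join x y <= - z + lg_join (z + x) (z + y).
  by move/(lg_leD2l z); rewrite addrA subrr add0r.
rewrite lg_leUx -{1}[x](addKr z) -{2}[y](addKr z) !lg_leD2l //.
  exact: lg_leUr.
exact: lg_leUl.
Qed.

End LGroupTheory.

(* An auxiliary closure property, equivalent to being the kernel of a unital
   l-homomorphism by [idealP_congr] and [congr_idealP] below; it is what the
   construction of the quotient needs. *)
Definition lcongruence (G : ulgroupType) (I : set G) : Prop :=
  [/\ I 0, forall x y, I x -> I y -> I (x - y),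
      forall z x y, I (x - y) -> I (lg_join x z - lg_join y z) &
      forall z x y, I (x - y) -> I (lg_meet x z - lg_meet y z)].

Record lcongr (G : ulgroupType) := LCongr {
  lcongr_set : set G;
  lcongrP : lcongruence lcongr_set
}.

Definition lcongr_pred (G : ulgroupType) (I : lcongr G) : pred G :=
  fun x => `[< lcongr_set I x >].

Lemma lcongr_zmod (G : ulgroupType) (I : lcongr G) :
  zmod_closed (lcongr_pred I).
Proof.
case: (lcongrP I) => I0 IB _ _; split; first exact/asboolP.
by move=> x y /asboolP Ix /asboolP Iy; apply/asboolP; exact: IB.
Qed.

HB.instance Definition _ (G : ulgroupType) (I : lcongr G) :=
  GRing.isZmodClosed.Build G (lcongr_pred I) (lcongr_zmod I).

Definition lcongr_closed (G : ulgroupType) (I : lcongr G) : zmodClosed G :=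
  GRing.ZmodClosed.clone G (lcongr_pred I) _.

Definition lquot (G : ulgroupType) (I : lcongr G) : Type :=
  Quotient.quot (lcongr_closed I).

HB.instance Definition _ (G : ulgroupType) (I : lcongr G) :=
  GRing.Zmodule.on (lquot I).

Definition lquot_pi (G : ulgroupType) (I : lcongr G) (x : G) : lquot I :=
  (\pi_(Quotient.quot (lcongr_closed I)) x)%qT.

Section LQuotient.
Variables (G : ulgroupType) (I : lcongr G).
Implicit Types (x y z : G) (X Y Z : lquot I).
Local Notation pi := (lquot_pi I).

Lemma lquot_piE x y : pi x = pi y <-> lcongr_set I (x - y).
Proof.
rewrite /lquot_pi; split.
  by move/eqP; rewrite -Quotient.idealrBE => /asboolP.
by move=> h; apply/eqP; rewrite -Quotient.idealrBE; exact/asboolP.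
Qed.

Lemma lquot_ind (P : lquot I -> Prop) : (forall x, P (pi x)) -> forall X, P X.
Proof. by move=> h X; rewrite -[X]reprK; exact: h. Qed.

Lemma lquot_piD x y : pi (x + y) = pi x + pi y.
Proof. exact: raddfD. Qed.

Lemma lquot_pi0 : pi 0 = 0.
Proof. exact: raddf0. Qed.

Lemma lquot_piMn x n : pi (x *+ n) = pi x *+ n.
Proof. exact: raddfMn. Qed.

Definition lquot_join X Y : lquot I :=
  pi (lg_join (repr (X : Quotient.quot (lcongr_closed I)))
                 (repr (Y : Quotient.quot (lcongr_closed I)))).

Definition lquot_meet X Y : lquot I :=
  pi (lg_meet (repr (X : Quotient.quot (lcongr_closed I)))
                 (repr (Y : Quotient.quot (lcongr_closed I)))).

Definition lquot_le X Y : bool := lquot_join X Y == Y.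

Lemma repr_lquot_pi x :
  lcongr_set I (repr (pi x : Quotient.quot (lcongr_closed I)) - x).
Proof. by apply/lquot_piE; exact: reprK. Qed.

Lemma lquot_piU x y : pi (lg_join x y) = lquot_join (pi x) (pi y).
Proof.
have [_ _ hU _] := lcongrP I.
symmetry; transitivity (pi (lg_join x
  (repr (pi y : Quotient.quot (lcongr_closed I))))).
  by apply/lquot_piE/hU/repr_lquot_pi.
by apply/lquot_piE; rewrite ![lg_join x _]lg_joinC; apply/hU/repr_lquot_pi.
Qed.

Lemma lquot_piI x y : pi (lg_meet x y) = lquot_meet (pi x) (pi y).
Proof.
have [_ _ _ hI] := lcongrP I.
symmetry; transitivity (pi (lg_meet x
  (repr (pi y : Quotient.quot (lcongr_closed I))))).
  by apply/lquot_piE/hI/repr_lquot_pi.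
by apply/lquot_piE; rewrite ![lg_meet x _]lg_meetC; apply/hI/repr_lquot_pi.
Qed.

Lemma lquot_joinC : commutative lquot_join.
Proof. by elim/lquot_ind=> x; elim/lquot_ind=> y; rewrite -!lquot_piU lg_joinC. Qed.

Lemma lquot_joinA : associative lquot_join.
Proof.
by do 3!elim/lquot_ind=> ?; rewrite -!lquot_piU lg_joinA.
Qed.

Lemma lquot_meetC : commutative lquot_meet.
Proof. by elim/lquot_ind=> x; elim/lquot_ind=> y; rewrite -!lquot_piI lg_meetC. Qed.

Lemma lquot_meetA : associative lquot_meet.
Proof.
by do 3!elim/lquot_ind=> ?; rewrite -!lquot_piI lg_meetA.
Qed.

Lemma lquot_joinKI Y X : lquot_meet X (lquot_join X Y) = X.
Proof.
elim/lquot_ind: Y => y; elim/lquot_ind: X => x.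
by rewrite -lquot_piU -lquot_piI lg_joinKI.
Qed.

Lemma lquot_meetKU Y X : lquot_join X (lquot_meet X Y) = X.
Proof.
elim/lquot_ind: Y => y; elim/lquot_ind: X => x.
by rewrite -lquot_piI -lquot_piU lg_meetKU.
Qed.

Lemma lquot_le_refl : reflexive lquot_le.
Proof. by elim/lquot_ind=> x; rewrite /lquot_le -lquot_piU lg_joinxx. Qed.

Lemma lquot_le_anti : antisymmetric lquot_le.
Proof. by move=> X Y /andP[/eqP XY /eqP YX]; rewrite -XY lquot_joinC YX. Qed.

Lemma lquot_le_trans : transitive lquot_le.
Proof.
by move=> Y X Z /eqP XY /eqP YZ; apply/eqP; rewrite -YZ lquot_joinA XY.
Qed.

Lemma lquot_leEmeet X Y : lquot_le X Y = (lquot_meet X Y == X).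
Proof.
apply/eqP/eqP => <-; first exact: lquot_joinKI.
by rewrite lquot_joinC lquot_meetC lquot_meetKU.
Qed.

Lemma lquot_lexI X Y Z :
  lquot_le X (lquot_meet Y Z) = lquot_le X Y && lquot_le X Z.
Proof.
have meetXX W : lquot_meet W W = W.
  by apply/eqP; rewrite -lquot_leEmeet lquot_le_refl.
rewrite !lquot_leEmeet; apply/eqP/andP => [XYZ|[/eqP XY /eqP XZ]].
  split; apply/eqP; rewrite -{1}XYZ -[RHS]XYZ.
    by rewrite -lquot_meetA [lquot_meet (lquot_meet Y Z) Y]lquot_meetC
               [lquot_meet Y (lquot_meet Y Z)]lquot_meetA meetXX.
  by rewrite -!lquot_meetA meetXX.
by rewrite lquot_meetA XY.
Qed.

Lemma lquot_leUx X Y Z :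
  lquot_le (lquot_join X Y) Z = lquot_le X Z && lquot_le Y Z.
Proof.
have joinXX W : lquot_join W W = W by apply/eqP; exact: lquot_le_refl.
rewrite /lquot_le; apply/eqP/andP => [XYZ|[/eqP XZ /eqP YZ]].
  split; apply/eqP; rewrite -{1}XYZ -[RHS]XYZ.
    by rewrite !lquot_joinA joinXX.
  by rewrite !lquot_joinA [lquot_join Y X]lquot_joinC -[lquot_join _ Y]lquot_joinA
             joinXX.
by rewrite -lquot_joinA YZ.
Qed.

End LQuotient.

HB.instance Definition _ (G : ulgroupType) (I : lcongr G) :=
  Order.Le_isPOrder.Build ring_display (lquot I)
    (@lquot_le_refl G I) (@lquot_le_anti G I) (@lquot_le_trans G I).

Lemma lquot_pi_le (G : ulgroupType) (I : lcongr G) (x y : G) :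
  x <= y -> lquot_pi I x <= lquot_pi I y.
Proof.
move=> xy; change (lquot_le (lquot_pi I x) (lquot_pi I y)).
by rewrite /lquot_le -lquot_piU (lg_join_r xy).
Qed.

Lemma lquot_leD2l (G : ulgroupType) (I : lcongr G) (Z X Y : lquot I) :
  X <= Y -> Z + X <= Z + Y.
Proof.
elim/lquot_ind: X => x; elim/lquot_ind: Y => y; elim/lquot_ind: Z => z.
move=> h; change (is_true (lquot_le (lquot_pi I x) (lquot_pi I y))) in h.
change (lquot_le (lquot_pi I z + lquot_pi I x) (lquot_pi I z + lquot_pi I y)).
rewrite /lquot_le -!lquot_piD -lquot_piU lg_addl_join.
by move/eqP: h; rewrite -lquot_piU => h; rewrite !lquot_piD h.
Qed.

Lemma lquot_unitP (G : ulgroupType) (I : lcongr G) (X : lquot I) :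
  exists N, forall n, (N <= n)%N -> X <= lquot_pi I lg_unit *+ n.
Proof.
elim/lquot_ind: X => x; have [N hN] := lg_unitP x; exists N => n Nn.
by rewrite -lquot_piMn; apply: lquot_pi_le; exact: hN.
Qed.

HB.instance Definition _ (G : ulgroupType) (I : lcongr G) :=
  POrderedZmodule_isLGroup.Build (lquot I)
    (@lquot_lexI G I) (@lquot_leUx G I) (@lquot_leD2l G I).

HB.instance Definition _ (G : ulgroupType) (I : lcongr G) :=
  LGroup_hasOrderUnit.Build (lquot I) (@lquot_unitP G I).

Lemma lquot_pi_ulhom (G : ulgroupType) (I : lcongr G) :
  is_ulhom (lquot_pi I : G -> lquot I).
Proof.
split=> //; [exact: lquot_piD | exact: lquot_piU | exact: lquot_piI].
Qed.

Lemma idealP_congr (G : ulgroupType) (I : ideal G) : lcongruence (ideal_set I).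
Proof.
case: (idealP I) => H [f [[fD fU fI _] ->]].
have f0 : f 0 = 0.
  by apply: (addrI (f 0)); rewrite -fD !addr0.
have fN x : f (- x) = - f x.
  by apply: (addrI (f x)); rewrite -fD !subrr.
have fB x y : f (x - y) = 0 -> f x = f y.
  by rewrite fD fN => /eqP; rewrite subr_eq0 => /eqP.
split; rewrite /hom_kernel /=; first exact: f0.
- by move=> x y fx fy; rewrite fD fN fx fy subrr.
- by move=> z x y /fB xy; rewrite fD fN !fU xy subrr.
- by move=> z x y /fB xy; rewrite fD fN !fI xy subrr.
Qed.

Lemma congr_idealP (G : ulgroupType) (I : set G) : lcongruence I ->
  exists (H : ulgroupType) (f : G -> H), is_ulhom f /\ I = hom_kernel f.
Proof.
move=> hI; pose J := LCongr hI.
exists (lquot J), (lquot_pi J); split; first exact: lquot_pi_ulhom.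
apply/seteqP; split=> x; rewrite /hom_kernel /= -(lquot_pi0 J).
  by move=> Ix; apply/lquot_piE; rewrite subr0.
by move/lquot_piE; rewrite subr0.
Qed.

Definition quotient (G : ulgroupType) (I : ideal G) : ulgroupType :=
  lquot (LCongr (idealP_congr I)).

Definition germinal_set (G : ulgroupType) (m : ideal G) : set G :=
  [set x | forall P : ideal G, prime_ideal P -> ideal_set P `<=` ideal_set m -> ideal_set P x].

Lemma germinal_congr (G : ulgroupType) (m : ideal G) :
  lcongruence (germinal_set m).
Proof.
split.
- by move=> P _ _; case: (idealP_congr P).
- by move=> x y hx hy P pP Pm; case: (idealP_congr P) => _ PB _ _;
    apply: PB; [exact: hx | exact: hy].
- by move=> z x y h P pP Pm; case: (idealP_congr P) => _ _ PU _;
    apply: PU; exact: h.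
- by move=> z x y h P pP Pm; case: (idealP_congr P) => _ _ _ PI;
    apply: PI; exact: h.
Qed.

Definition germinal_ideal (G : ulgroupType) (m : ideal G) : ideal G :=
  Ideal (congr_idealP (germinal_congr m)).

(* The additive group of the reals, with its usual order and order unit 1. *)
Definition real_ulgroup (R : realType) : Type := R.

HB.instance Definition _ (R : realType) :=
  Num.POrderedZmodule.copy (real_ulgroup R) R.

Section RealULGroup.
Variable R : realType.

Lemma real_lexI (x y z : real_ulgroup R) :
  (x <= Num.min (y : R) z) = (x <= y) && (x <= z).
Proof. exact: (@le_min _ R). Qed.

Lemma real_leUx (x y z : real_ulgroup R) :
  ((Num.max (x : R) y : real_ulgroup R) <= z) = (x <= z) && (y <= z).
Proof. exact: (@ge_max _ R). Qed.

Lemma real_leD2l (z x y : real_ulgroup R) : x <= y -> z + x <= z + y.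
Proof. by move=> xy; rewrite (@lerD2l R). Qed.

Lemma real_unitP (x : real_ulgroup R) :
  exists N, forall n, (N <= n)%N -> x <= ((1 : R) : real_ulgroup R) *+ n.
Proof.
exists (Num.bound `|x : R|) => n Nn; apply: (@le_trans _ R `|x : R|).
  exact: (@ler_norm R).
apply: (@le_trans _ R (Num.bound `|x : R|)%:R).
  exact/ltW/archi_boundP/normr_ge0.
by rewrite (@ler_nat R).
Qed.

End RealULGroup.

HB.instance Definition _ (R : realType) :=
  POrderedZmodule_isLGroup.Build (real_ulgroup R)
    (@real_lexI R) (@real_leUx R) (@real_leD2l R).

HB.instance Definition _ (R : realType) :=
  LGroup_hasOrderUnit.Build (real_ulgroup R) (@real_unitP R).

Definition unit_square (R : realType) : set (R * R) :=
  [set x | 0 <= x.1 <= 1 /\ 0 <= x.2 <= 1].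

Arguments unit_square : clear implicits.

Definition affine_int (R : realType) (p : int * int * int) (x : R * R) : R :=
  p.1.1%:~R * x.1 + p.1.2%:~R * x.2 + p.2%:~R.

(* The finitely many pieces are the sets where f agrees with a member of s. *)
Definition piecewise_affine_int (R : realType) (f : unit_square R -> R) : Prop :=
  exists s : seq (int * int * int),
    forall x : unit_square R,
      exists2 p, p \in s & f x = affine_int p (set_val x).

(* The free unital l-group on two generators (the two coordinate functions), in
   its model as integral piecewise linear functions. *)
Record F2 (R : realType) := MkF2 {
  F2_fun : unit_square R -> R;
  F2_subproof : `[< continuous F2_fun /\ piecewise_affine_int F2_fun >]
}.

HB.instance Definition _ (R : realType) := [isSub for @F2_fun R].
HB.instance Definition _ (R : realType) := [Choice of F2 R by <:].

Section F2Closed.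
Variable R : realType.
Implicit Types f g : unit_square R -> R.

Lemma piecewise_affine_int_op (op : R -> R -> R) f g :
  (forall p q, exists s : seq (int * int * int), forall x : R * R,
     exists2 r, r \in s &
       op (affine_int p x) (affine_int q x) = affine_int r x) ->
  piecewise_affine_int f -> piecewise_affine_int g ->
  piecewise_affine_int (fun x => op (f x) (g x)).
Proof.
move=> hop [s hs] [t ht]; pose h pq := projT1 (cid (hop pq.1 pq.2)).
exists (flatten [seq h (p, q) | p <- s, q <- t]) => x.
have [p ps ->] := hs x; have [q qt ->] := ht x.
have [r rs ->] := projT2 (cid (hop p q)) (set_val x).
exists r => //; apply/flattenP; exists (h (p, q)) => //.
exact: allpairs_f.
Qed.

Lemma F2_cst1 : `[< continuous (fun _ : unit_square R => 1 : R) /\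
  piecewise_affine_int (fun _ : unit_square R => 1 : R) >].
Proof.
apply/asboolP; split; first exact: cst_continuous.
exists [:: (0, 0, 1)] => x; exists (0, 0, 1); first by rewrite inE.
by rewrite /affine_int /= !mul0r !add0r.
Qed.

Lemma F2_cst0 : `[< continuous (fun _ : unit_square R => 0 : R) /\
  piecewise_affine_int (fun _ : unit_square R => 0 : R) >].
Proof.
apply/asboolP; split; first exact: cst_continuous.
exists [:: (0, 0, 0)] => x; exists (0, 0, 0); first by rewrite inE.
by rewrite /affine_int /= !mul0r !add0r.
Qed.

Lemma F2_closedD (f g : F2 R) :
  `[< continuous (fun x => F2_fun f x + F2_fun g x) /\
      piecewise_affine_int (fun x => F2_fun f x + F2_fun g x) >].
Proof.
case: f g => [f /asboolP[cf pf]] [g /asboolP[cg pg]] /=; apply/asboolP; split.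
  by move=> x; exact: (@continuousD _ _ _ f g x (cf x) (cg x)).
apply: (piecewise_affine_int_op (op := +%R)) => // -[[a b] c] [[a' b'] c'].
exists [:: (a + a', b + b', c + c')] => x.
exists (a + a', b + b', c + c'); first by rewrite inE.
by rewrite /affine_int /= !intrD; ring.
Qed.

Lemma F2_closedN (f : F2 R) :
  `[< continuous (fun x => - F2_fun f x) /\
      piecewise_affine_int (fun x => - F2_fun f x) >].
Proof.
case: f => [f /asboolP[cf pf]] /=; apply/asboolP; split.
  by move=> x; exact: (@continuousN _ _ _ f x (cf x)).
apply: (piecewise_affine_int_op (op := fun u _ => - u) _ pf pf).
move=> -[[a b] c] _; exists [:: (- a, - b, - c)] => x.
exists (- a, - b, - c); first by rewrite inE.
by rewrite /affine_int /= !mulrNz; ring.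
Qed.

Lemma F2_closedI (f g : F2 R) :
  `[< continuous (fun x => Num.min (F2_fun f x) (F2_fun g x)) /\
      piecewise_affine_int (fun x => Num.min (F2_fun f x) (F2_fun g x)) >].
Proof.
case: f g => [f /asboolP[cf pf]] [g /asboolP[cg pg]] /=; apply/asboolP; split.
  by move=> x; exact: (@continuous_min _ _ f g x (cf x) (cg x)).
apply: (piecewise_affine_int_op (op := Num.min)) => // p q.
exists [:: p; q] => x; case: leP => _.
  by exists p => //; rewrite inE eqxx.
by exists q => //; rewrite !inE eqxx orbT.
Qed.

Lemma F2_closedU (f g : F2 R) :
  `[< continuous (fun x => Num.max (F2_fun f x) (F2_fun g x)) /\
      piecewise_affine_int (fun x => Num.max (F2_fun f x) (F2_fun g x)) >].
Proof.
case: f g => [f /asboolP[cf pf]] [g /asboolP[cg pg]] /=; apply/asboolP; split.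
  by move=> x; exact: (@continuous_max _ _ f g x (cf x) (cg x)).
apply: (piecewise_affine_int_op (op := Num.max)) => // p q.
exists [:: p; q] => x; case: leP => _.
  by exists q => //; rewrite !inE eqxx orbT.
by exists p => //; rewrite inE eqxx.
Qed.

Definition F2_zero : F2 R := MkF2 F2_cst0.
Definition F2_one : F2 R := MkF2 F2_cst1.
Definition F2_add (f g : F2 R) : F2 R := MkF2 (F2_closedD f g).
Definition F2_opp (f : F2 R) : F2 R := MkF2 (F2_closedN f).
Definition F2_meet (f g : F2 R) : F2 R := MkF2 (F2_closedI f g).
Definition F2_join (f g : F2 R) : F2 R := MkF2 (F2_closedU f g).
Definition F2_le (f g : F2 R) : bool :=
  `[< forall x, F2_fun f x <= F2_fun g x >].

Lemma F2P (f g : F2 R) : (forall x, F2_fun f x = F2_fun g x) -> f = g.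
Proof. by move=> fg; apply: val_inj; apply/funext. Qed.

Lemma F2_addA : associative F2_add.
Proof. by move=> f g h; apply: F2P => x; exact: addrA. Qed.

Lemma F2_addC : commutative F2_add.
Proof. by move=> f g; apply: F2P => x; exact: addrC. Qed.

Lemma F2_add0 : left_id F2_zero F2_add.
Proof. by move=> f; apply: F2P => x; exact: add0r. Qed.

Lemma F2_addN : left_inverse F2_zero F2_opp F2_add.
Proof. by move=> f; apply: F2P => x; exact: addNr. Qed.

Lemma F2_le_refl : reflexive F2_le.
Proof. by move=> f; apply/asboolP => x. Qed.

Lemma F2_le_anti : antisymmetric F2_le.
Proof.
move=> f g /andP[/asboolP fg /asboolP gf]; apply: F2P => x.
by apply/eqP; rewrite eq_le fg gf.
Qed.

Lemma F2_le_trans : transitive F2_le.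
Proof.
move=> g f h /asboolP fg /asboolP gh; apply/asboolP => x.
exact: le_trans (gh x).
Qed.

End F2Closed.

HB.instance Definition _ (R : realType) :=
  GRing.isZmodule.Build (F2 R)
    (@F2_addA R) (@F2_addC R) (@F2_add0 R) (@F2_addN R).

HB.instance Definition _ (R : realType) :=
  Order.Le_isPOrder.Build ring_display (F2 R)
    (@F2_le_refl R) (@F2_le_anti R) (@F2_le_trans R).

Section F2LGroup.
Variable R : realType.
Implicit Types f g h : F2 R.

Lemma F2_leP f g : reflect (forall x, F2_fun f x <= F2_fun g x) (f <= g).
Proof. exact: asboolP. Qed.

Lemma F2_lexI f g h : (f <= F2_meet g h) = (f <= g) && (f <= h).
Proof.
apply/F2_leP/andP => [fgh|[/F2_leP fg /F2_leP fh] x].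
  by split; apply/F2_leP => x; move: (fgh x); rewrite le_min => /andP[].
by rewrite le_min fg fh.
Qed.

Lemma F2_leUx f g h : (F2_join f g <= h) = (f <= h) && (g <= h).
Proof.
apply/F2_leP/andP => [fgh|[/F2_leP fh /F2_leP gh] x].
  by split; apply/F2_leP => x; move: (fgh x); rewrite ge_max => /andP[].
by rewrite ge_max fh gh.
Qed.

Lemma F2_leD2l h f g : f <= g -> h + f <= h + g.
Proof. by move=> /F2_leP fg; apply/F2_leP => x; rewrite lerD2l. Qed.

Lemma F2_funMn f n x : F2_fun (f *+ n) x = F2_fun f x *+ n.
Proof.
by elim: n => [//|n IHn]; rewrite !mulrS -IHn.
Qed.

Lemma F2_unitP f :
  exists N, forall n, (N <= n)%N -> f <= F2_one R *+ n.
Proof.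
have [_ [s hs]] := asboolP _ (F2_subproof f).
pose size_aff (p : int * int * int) : nat :=
  (`|p.1.1| + `|p.1.2| + `|p.2|)%N.
have natz (a : int) : (`|a|%N)%:R = `|a%:~R : R|.
  by rewrite -intr_norm -abszE.
exists (\sum_(p <- s) size_aff p)%N => n Nn; apply/F2_leP => x.
rewrite F2_funMn; have [p ps ->] := hs x.
apply: (@le_trans _ _ (size_aff p)%:R); last first.
  rewrite ler_nat; apply: leq_trans Nn.
  by rewrite (big_rem p) //= leq_addr.
have [/andP[x1 x1'] /andP[x2 x2']] := set_valP x.
rewrite /affine_int /size_aff !natrD !natz; apply: lerD; last exact: ler_norm.
apply: lerD; apply: le_trans (ler_norm _) _; rewrite normrM ler_piMr //.
  by rewrite ger0_norm.
by rewrite ger0_norm.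
Qed.

End F2LGroup.

HB.instance Definition _ (R : realType) :=
  POrderedZmodule_isLGroup.Build (F2 R)
    (@F2_lexI R) (@F2_leUx R) (@F2_leD2l R).

HB.instance Definition _ (R : realType) :=
  LGroup_hasOrderUnit.Build (F2 R) (@F2_unitP R).

Definition ideal_at (R : realType) (x : unit_square R) : set (F2 R) :=
  [set f | F2_fun f x = 0].

Definition in_interior (R : realType) (m : ideal (F2 R)) : Prop :=
  exists x : unit_square R,
    [/\ 0 < (set_val x).1 < 1, 0 < (set_val x).2 < 1 &
        ideal_set m = ideal_at x].

(* The union of the ranges of all embeddings of G/m in the reals; for m maximal
   there is exactly one such embedding by Hoelder's theorem, and this is the
   image of G/m under it. *)
Definition holder_group (R : realType) (G : ulgroupType) (m : ideal G) :
    set R :=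
  [set r | exists e : quotient m -> real_ulgroup R,
     [/\ is_ulhom e, injective e & range e r]].

Definition Z_independent (R : realType) (n : nat) (v : 'I_n -> R) : Prop :=
  forall c : 'I_n -> int, \sum_(i < n) (c i)%:~R * v i = 0 ->
    forall i, c i = 0.

Definition has_rank (R : realType) (A : set R) (n : nat) : Prop :=
  (exists2 v : 'I_n -> R, range v `<=` A & Z_independent v) /\
  (forall (k : nat) (v : 'I_k -> R), range v `<=` A -> Z_independent v ->
     (k <= n)%N).

Definition least_pos_rat (R : realType) (A : set R) (q : rat) : Prop :=
  [/\ 0 < q, A (ratr q) & forall r : rat, 0 < r -> A (ratr r) -> q <= r].

(* Main.v *)
Require Import Defs.
From HB Require Import structures.
From mathcomp Require Import all_boot all_order all_algebra.
From mathcomp Require Import all_classical all_reals all_analysis.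
From mathcomp Require Import ring lra zify.

Set Implicit Arguments.
Unset Strict Implicit.
Unset Printing Implicit Defensive.

Import Order.TTheory GRing.Theory Num.Theory.
Import numFieldNormedType.Exports.

Local Open Scope classical_set_scope.
Local Open Scope ring_scope.
Local Open Scope card_scope.

(** A point x of the square gives the group span x = Z x1 + Z x2 + Z, the image
    of evaluation at x. A unital homomorphism from F2 to the reals that kills
    the functions vanishing near x can only be evaluation at x ([ev_unique]),
    because inequalities between f(x) and rational numbers persist near x.
    Hence the quotients by two maximal ideals are isomorphic exactly when their
    spans are equal ([quotient_isoP]), and an isomorphism between the germinal
    quotients always forces equality of the spans ([germinal_iso_span]). The
    germinal ideal itself is the set of functions vanishing near x
    ([germinal_setE]); the prime ideals needed for this are zero sets along
    ultrafilters converging to x.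

    The converse direction depends on the rank. In rank 3 there is no integral
    affine relation at x, so each f is affine with determined coefficients near
    x, and the germinal ideal is the maximal ideal. For lower rank, an element
    of the affine group of the lattice Z^2 that maps x to y, both interior,
    induces an isomorphism of germs ([affine_equiv_germinal_iso]). Rational
    points with the same span are equivalent to the same point (0, 1/d)
    ([rank1_affine_equiv]). In rank 2 a point is equivalent to (c/d, t) with
    c/d in lowest terms and t irrational; 1/d is the least positive rational of
    the span, the span determines t up to sign and translation by multiples of
    1/d, and these are realized by affine maps fixing the first coordinate. So
    for a fixed span only c is left, and changing c modulo d or changing its
    sign is again affine. This gives at most max(1, phi(d)/2) classes.

    That there are no fewer is [germinal_iso_relation]. Let L = d X1 - c be the
    relation at x = (c/d, t) and L' the relation at y = (c'/d, t). Composing an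
    isomorphism of germs with the passage to an ultrafilter that converges to y
    off the line L' = 0 yields a homomorphism h from F2 to a totally ordered
    group in which every element is given by one affine piece. Near x a
    function vanishing at x takes its values among finitely many integer
    multiples of L, a fact expressed by the vanishing of a lattice term, so h
    maps such a function to an integer multiple of h(L). By surjectivity L' is
    a multiple of h(L), and since L' is primitive, h(L) = L' or h(L) = - L'.
    As L + c is divisible by d, so is h(L) + c, that is, d divides c - c' or
    c + c'. *)

(** * Homomorphisms and quotients of unital l-groups *)

Section UnitalHomomorphisms.
Variables G H K : ulgroupType.
Implicit Types f : G -> H.

Lemma ulhom0 f : is_ulhom f -> f 0 = 0.
Proof.
by case=> fD _ _ _; apply: (addrI (f 0)); rewrite -fD !addr0.
Qed.

Lemma ulhomN f : is_ulhom f -> {morph f : x / - x}.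
Proof.
move=> hf x; have [fD _ _ _] := hf.
by apply: (addrI (f x)); rewrite -fD !subrr (ulhom0 hf).
Qed.

Lemma ulhomB f : is_ulhom f -> {morph f : x y / x - y}.
Proof. by move=> hf x y; have [fD _ _ _] := hf; rewrite fD (ulhomN hf). Qed.

Lemma ulhomMn f n : is_ulhom f -> {morph f : x / x *+ n}.
Proof.
move=> hf x; have [fD _ _ _] := hf.
by elim: n => [|n IHn]; rewrite ?mulr0n ?(ulhom0 hf)// !mulrS fD IHn.
Qed.

Lemma ulhomMz f (k : int) : is_ulhom f -> {morph f : x / x *~ k}.
Proof.
move=> hf x; case: k => n; first exact: ulhomMn.
by rewrite !NegzE !mulrNz (ulhomN hf) -!pmulrn (ulhomMn _ hf).
Qed.

Lemma ulhom_le f x y : is_ulhom f -> x <= y -> f x <= f y.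
Proof.
by case=> _ fU _ _ /lg_join_r xy; rewrite -xy fU; exact: lg_leUl.
Qed.

Lemma ulhom_comp f (g : H -> K) :
  is_ulhom f -> is_ulhom g -> is_ulhom (g \o f).
Proof.
case=> fD fU fI f1 [gD gU gI g1]; split=> /=; last by rewrite f1.
- by move=> x y /=; rewrite fD gD.
- by move=> x y /=; rewrite fU gU.
- by move=> x y /=; rewrite fI gI.
Qed.

Lemma ulhom_inv f (g : H -> G) :
  is_ulhom f -> cancel f g -> cancel g f -> is_ulhom g.
Proof.
case=> fD fU fI f1 fK gK; split; last by rewrite -f1 fK.
- by move=> x y; rewrite -{1}[x]gK -{1}[y]gK -fD fK.
- by move=> x y; rewrite -{1}[x]gK -{1}[y]gK -fU fK.
- by move=> x y; rewrite -{1}[x]gK -{1}[y]gK -fI fK.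
Qed.

End UnitalHomomorphisms.

Lemma ul_iso_refl (G : ulgroupType) : ul_iso G G.
Proof. by exists idfun; split; [split | exists idfun]. Qed.

Lemma ul_iso_sym (G H : ulgroupType) : ul_iso G H -> ul_iso H G.
Proof.
case=> f [hf [g fK gK]]; exists g; split; last by exists f.
exact: ulhom_inv hf fK gK.
Qed.

Lemma ul_iso_trans (G H K : ulgroupType) :
  ul_iso G H -> ul_iso H K -> ul_iso G K.
Proof.
case=> f [hf bf] [g [hg bg]]; exists (g \o f).
by split; [exact: ulhom_comp | exact: bij_comp].
Qed.

(** Ideals contain x and |x| together and are convex, so membership in an ideal
    can be tested on absolute values by inequalities. *)
Definition lg_abs (G : lgroupType) (x : G) : G := lg_join x (- x).

Lemma lg_abs_eq0 (G : lgroupType) (x : G) : lg_abs x = 0 -> x = 0.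
Proof.
move=> x0; have x_le0 : x <= 0 by rewrite -x0 lg_leUl.
apply/eqP; rewrite eq_le x_le0 /=.
have /(lg_leD2l x) : - x <= 0 by rewrite -x0 lg_leUr.
by rewrite subrr addr0.
Qed.

Lemma lg_abs0 (G : lgroupType) : lg_abs (0 : G) = 0.
Proof. by rewrite /lg_abs oppr0 lg_joinxx. Qed.

Lemma ulhom_abs (G H : ulgroupType) (f : G -> H) :
  is_ulhom f -> {morph f : x / lg_abs x}.
Proof.
by move=> hf x; have [_ fU _ _] := hf; rewrite /lg_abs fU (ulhomN hf).
Qed.

Lemma lg_meet_l (G : lgroupType) (x y : G) : x <= y -> lg_meet x y = x.
Proof. exact: (@meet_l _ (lg_lattice G)). Qed.

Lemma lg_meet_r (G : lgroupType) (x y : G) : y <= x -> lg_meet x y = y.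
Proof. exact: (@meet_r _ (lg_lattice G)). Qed.

Section QuotientMaps.
Variable G : ulgroupType.
Implicit Types I J : ideal G.

Definition qpi I : G -> quotient I :=
  lquot_pi (LCongr (idealP_congr I)).

Lemma qpi_hom I : is_ulhom (qpi I).
Proof. exact: lquot_pi_ulhom. Qed.

Lemma qpi_surj I (X : quotient I) : exists x, qpi I x = X.
Proof. by elim/lquot_ind: X => x; exists x. Qed.

Lemma qpiE I x y : qpi I x = qpi I y <-> ideal_set I (x - y).
Proof. exact: lquot_piE. Qed.

Lemma qpi_eq0 I x : qpi I x = 0 <-> ideal_set I x.
Proof. by rewrite -(ulhom0 (qpi_hom I)) qpiE subr0. Qed.

Lemma ideal_eq I J : ideal_set I = ideal_set J -> I = J.
Proof.
case: I J => [I hI] [J hJ] /= IJ; move: hI; rewrite IJ => hI.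
by rewrite (Prop_irrelevance hI hJ).
Qed.

(** The homomorphism theorem; the induced map is built from a choice of
    representatives. *)
Lemma quotient_factor I (H : ulgroupType) (h : G -> H) : is_ulhom h ->
  (forall x, ideal_set I x -> h x = 0) ->
  exists2 k : quotient I -> H, is_ulhom k & forall x, k (qpi I x) = h x.
Proof.
move=> hh hI; pose s (X : quotient I) : G := projT1 (cid (qpi_surj X)).
have sK X : qpi I (s X) = X := projT2 (cid (qpi_surj X)).
have kE x : h (s (qpi I x)) = h x.
  by apply/eqP; rewrite -subr_eq0 -(ulhomB hh); apply/eqP/hI/qpiE/sK.
have [qD qU qI q1] := qpi_hom I; have [hD hU h_I h1] := hh.
exists (h \o s) => //=; split=> /=; last by rewrite -q1 kE.
- by move=> X Y /=; rewrite -{1}[X]sK -{1}[Y]sK -qD kE hD.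
- by move=> X Y /=; rewrite -{1}[X]sK -{1}[Y]sK -qU kE hU.
- by move=> X Y /=; rewrite -{1}[X]sK -{1}[Y]sK -qI kE h_I.
Qed.

(** Two endomorphisms of the group that are mutually inverse only modulo the
    ideals still induce inverse isomorphisms of the quotients; this is how
    maps that are inverse to each other near a point are used. *)
Lemma quotient_iso I J (p q : G -> G) : is_ulhom p -> is_ulhom q ->
  (forall x, ideal_set I x -> ideal_set J (p x)) ->
  (forall x, ideal_set J x -> ideal_set I (q x)) ->
  (forall x, ideal_set I (q (p x) - x)) ->
  (forall x, ideal_set J (p (q x) - x)) ->
  ul_iso (quotient I) (quotient J).
Proof.
move=> hp hq pIJ qJI qpK pqK.
have [P hP PE] : exists2 P : quotient I -> quotient J,
    is_ulhom P & forall x, P (qpi I x) = qpi J (p x).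
  have hc := ulhom_comp hp (qpi_hom J).
  by apply: (quotient_factor hc) => x /pIJ /qpi_eq0.
have [Q hQ QE] : exists2 Q : quotient J -> quotient I,
    is_ulhom Q & forall x, Q (qpi J x) = qpi I (q x).
  have hc := ulhom_comp hq (qpi_hom I).
  by apply: (quotient_factor hc) => x /qJI /qpi_eq0.
exists P; split=> //; exists Q => X; have [x <-] := qpi_surj X.
  by rewrite PE QE; apply/qpiE/qpK.
by rewrite QE PE; apply/qpiE/pqK.
Qed.

Lemma ideal_abs I x : ideal_set I x <-> ideal_set I (lg_abs x).
Proof.
rewrite -!qpi_eq0 (ulhom_abs (qpi_hom I)).
by split=> [->|/lg_abs_eq0//]; rewrite lg_abs0.
Qed.

Lemma ideal_convex I x y : 0 <= x -> x <= y -> ideal_set I y -> ideal_set I x.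
Proof.
move=> x0 xy; rewrite -!qpi_eq0 => y0; apply/eqP.
rewrite eq_le -{1}y0 (ulhom_le (qpi_hom I) xy) /=.
by rewrite -(ulhom0 (qpi_hom I)) (ulhom_le (qpi_hom I) x0).
Qed.

Lemma idealD I x y : ideal_set I x -> ideal_set I y -> ideal_set I (x + y).
Proof.
by have [D _ _ _] := qpi_hom I; rewrite -!qpi_eq0 D => -> ->; rewrite addr0.
Qed.

Lemma idealMn I x n : ideal_set I x -> ideal_set I (x *+ n).
Proof. by rewrite -!qpi_eq0 (ulhomMn _ (qpi_hom I)) => ->; rewrite mul0rn. Qed.

(** Every element is bounded above by a multiple of the unit, so in a quotient
    that kills the unit all elements and their opposites are nonpositive. *)
Lemma ideal_unit I : ideal_set I lg_unit -> ideal_set I = setT.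
Proof.
move=> /qpi_eq0 I1; have [_ _ _ q1] := qpi_hom I.
have le0 x : qpi I x <= 0.
  have [N /(_ N (leqnn _)) /(ulhom_le (qpi_hom I))] := lg_unitP x.
  by rewrite (ulhomMn _ (qpi_hom I)) I1 mul0rn.
apply/seteqP; split=> // x _; apply/qpi_eq0/eqP; rewrite eq_le le0 /=.
have /(lg_leD2l (qpi I x)) := le0 (- x).
by rewrite (ulhomN (qpi_hom I)) subrr addr0.
Qed.

End QuotientMaps.

(** * Germs and evaluations of functions on the square *)

Section PointsAndFunctions.
Variable R : realType.
Implicit Types (f g h : F2 R) (u x y : unit_square R) (p q : int * int * int).

Definition sqpt (a b : R) (ha : 0 <= a <= 1) (hb : 0 <= b <= 1) :
    unit_square R :=
  SigSub (mem_set (conj ha hb : unit_square R (a, b))).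

Lemma sqptE a b ha hb : set_val (@sqpt a b ha hb) = (a, b).
Proof. by []. Qed.

Lemma sq_bounds u : 0 <= (set_val u).1 <= 1 /\ 0 <= (set_val u).2 <= 1.
Proof. exact: set_valP u. Qed.

Lemma F2_continuous f : continuous (F2_fun f).
Proof. by have [] := asboolP _ (F2_subproof f). Qed.

Lemma F2_piecewise f : piecewise_affine_int (F2_fun f).
Proof. by have [] := asboolP _ (F2_subproof f). Qed.

Lemma set_val_continuous : continuous (fun u => set_val u : R * R).
Proof. exact: initial_continuous. Qed.

Lemma fst_continuous : continuous (fun u => (set_val u).1 : R).
Proof.
move=> u; apply: (@continuous_comp _ _ _ (fun u => set_val u : R * R) fst).
  exact: set_val_continuous.
exact: cvg_fst.
Qed.

Lemma snd_continuous : continuous (fun u => (set_val u).2 : R).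
Proof.
move=> u; apply: (@continuous_comp _ _ _ (fun u => set_val u : R * R) snd).
  exact: set_val_continuous.
exact: cvg_snd.
Qed.

Lemma affine_continuous p : continuous (fun u => affine_int p (set_val u) : R).
Proof.
have cM (k : int) (c : unit_square R -> R) : continuous c ->
    continuous (fun u => k%:~R * c u : R).
  move=> cc u; apply: (@continuousM _ _ (fun=> k%:~R) c u) (cc u).
  exact: cst_continuous.
move=> u; apply: (@continuousD _ _ _ (fun u => p.1.1%:~R * (set_val u).1 +
  p.1.2%:~R * (set_val u).2) (fun=> p.2%:~R)); last exact: cst_continuous.
apply: (@continuousD _ _ _ (fun u => p.1.1%:~R * (set_val u).1)
  (fun u => p.1.2%:~R * (set_val u).2)); apply: cM.
  exact: fst_continuous.
exact: snd_continuous.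
Qed.

Lemma aff_subproof p : `[< continuous (fun u => affine_int p (set_val u) : R) /\
  piecewise_affine_int (fun u => affine_int p (set_val u) : R) >].
Proof.
apply/asboolP; split; first exact: affine_continuous.
by exists [:: p] => u; exists p; rewrite ?inE.
Qed.

Definition aff p : F2 R := MkF2 (aff_subproof p).

Lemma affE p u : F2_fun (aff p) u = affine_int p (set_val u).
Proof. by []. Qed.

Definition scale_int (k : int) p : int * int * int :=
  (k * p.1.1, k * p.1.2, k * p.2).

Lemma affine_int_scale k p (z : R * R) :
  affine_int (scale_int k p) z = k%:~R * affine_int p z.
Proof. by rewrite /affine_int /= !intrM; ring. Qed.

Lemma affine_intB p q (z : R * R) :
  affine_int (p - q) z = affine_int p z - affine_int q z.
Proof. by rewrite /affine_int /= !intrB; ring. Qed.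

Lemma affine_intD p q (z : R * R) :
  affine_int (p + q) z = affine_int p z + affine_int q z.
Proof. by rewrite /affine_int /= !intrD; ring. Qed.

Lemma affine_int0 (z : R * R) : affine_int 0 z = 0.
Proof. by rewrite /affine_int /=; ring. Qed.

Lemma F2_funD f g u : F2_fun (f + g) u = F2_fun f u + F2_fun g u.
Proof. by []. Qed.

Lemma F2_funN f u : F2_fun (- f) u = - F2_fun f u.
Proof. by []. Qed.

Lemma F2_funB f g u : F2_fun (f - g) u = F2_fun f u - F2_fun g u.
Proof. by []. Qed.

Lemma F2_fun0 u : F2_fun (0 : F2 R) u = 0.
Proof. by []. Qed.

Lemma F2_fun1 u : F2_fun (lg_unit : F2 R) u = 1.
Proof. by []. Qed.

Lemma F2_funU f g u :
  F2_fun (lg_join f g) u = Num.max (F2_fun f u) (F2_fun g u).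
Proof. by []. Qed.

Lemma F2_funI f g u :
  F2_fun (lg_meet f g) u = Num.min (F2_fun f u) (F2_fun g u).
Proof. by []. Qed.

Lemma F2_funMz f (k : int) u : F2_fun (f *~ k) u = k%:~R * F2_fun f u.
Proof.
case: k => n; first by rewrite -pmulrn F2_funMn mulr_natl.
rewrite NegzE !mulrNz F2_funN -pmulrn F2_funMn mulNr.
by rewrite mulr_natl.
Qed.

Lemma F2_fun_abs f u : F2_fun (lg_abs f) u = `|F2_fun f u|.
Proof.
rewrite F2_funU F2_funN; case: ger0P => h; [apply: max_l | apply: max_r].
  by rewrite (le_trans _ h) // oppr_le0.
by rewrite ltW // (lt_le_trans h) // oppr_ge0 ltW.
Qed.

Lemma nbhs_box x (A : set (unit_square R)) : nbhs x A ->
  exists2 e : R, 0 < e & forall u, `|(set_val u).1 - (set_val x).1| < e ->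
                     `|(set_val u).2 - (set_val x).2| < e -> A u.
Proof.
case=> _ [[B oB <-] /= Bx BA].
have : nbhs (set_val x) B by exact: open_nbhs_nbhs.
move=> /nbhs_ballP[e /= e0 eB]; exists e => // u u1 u2.
by apply/BA/eB; split; rewrite /ball /= distrC.
Qed.

Definition ev x (f : F2 R) : real_ulgroup R := F2_fun f x.

Lemma ev_hom x : is_ulhom (ev x).
Proof. by []. Qed.

Definition maxid x : ideal (F2 R) := Ideal (ex_intro _ _ (ex_intro _ (ev x)
  (conj (ev_hom x) erefl))).

Lemma maxidE x : ideal_set (maxid x) = ideal_at x.
Proof. by []. Qed.

(** A piece that differs from f at x differs from it near x by continuity, so it
    can be discarded there. *)
Lemma local_pieces f x : exists s : seq (int * int * int),
  (forall p, p \in s -> affine_int p (set_val x) = F2_fun f x) /\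
  \forall u \near x, exists2 p, p \in s & F2_fun f u = affine_int p (set_val u).
Proof.
have [s hs] := F2_piecewise f.
pose good p := affine_int p (set_val x) == F2_fun f x.
exists [seq p <- s | good p]; split.
  by move=> p; rewrite seq.mem_filter => /andP[/eqP].
have : \forall u \near x, forall p, p \in s -> ~~ good p ->
    F2_fun f u != affine_int p (set_val u).
  elim: {hs} s => [|p s IHs]; first by near=> u.
  have IHp : \forall u \near x, ~~ good p ->
      F2_fun f u != affine_int p (set_val u).
    have [gp|gp] := boolP (good p); first by near=> u.
    have := cvgr_neq0 _ (@F2_continuous (f - aff p) x).
    rewrite F2_funB subr_eq0 eq_sym => /(_ _ gp); apply: filterS => u + _.
    by rewrite F2_funB subr_eq0.
  apply: filterS2 IHp IHs => u hp hs q; rewrite inE => /orP[/eqP ->|]//.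
  exact: hs.
apply: filterS => u hu; have [p ps fp] := hs u; exists p => //.
rewrite seq.mem_filter ps andbT; apply: contraT => /(hu p ps).
by rewrite fp eqxx.
Unshelve. all: by end_near. Qed.

Definition germ0 x f : Prop := \forall u \near x, F2_fun f u = 0.

Lemma germ0_ev x f : germ0 x f -> F2_fun f x = 0.
Proof. exact: nbhs_singleton. Qed.

End PointsAndFunctions.

Section Points.
Variable R : realType.
Implicit Types (f g : F2 R) (u x y : unit_square R) (p q : int * int * int).
Implicit Types (m n : ideal (F2 R)).

Lemma ulhom_realMz (G : ulgroupType) (h : G -> real_ulgroup R) (k : int) :
  is_ulhom h -> (h (lg_unit *~ k) : R) = k%:~R.
Proof. by move=> hh; have [_ _ _ h1] := hh; rewrite (ulhomMz _ hh) h1. Qed.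

(** If k < N f(x) for an integer k then (k - N f) v 0 has zero germ at x, so
    its image vanishes and k <= N h(f); since the rationals are dense, this
    bounds h(f) from below by f(x). *)
Lemma ev_unique x (h : F2 R -> real_ulgroup R) : is_ulhom h ->
  (forall f, germ0 x f -> h f = 0) -> forall f, (h f : R) = F2_fun f x.
Proof.
move=> hh h0.
have lower f : F2_fun f x <= (h f : R).
  rewrite leNgt; apply/negP => lt_hf.
  have d0 : 0 < F2_fun f x - (h f : R) by rewrite subr_gt0.
  pose N := Num.bound (2 / (F2_fun f x - (h f : R))).
  have hN : 2 < N%:R * (F2_fun f x - (h f : R)).
    rewrite -ltr_pdivrMr //; apply: archi_boundP.
    by rewrite divr_ge0 // ltW.
  pose k := (Num.ceil (N%:R * F2_fun f x) - 1)%R.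
  have /andP[k1 k2] : k%:~R < N%:R * F2_fun f x <= k%:~R + 1.
    by rewrite /k; have := ceil_itv (N%:R * F2_fun f x); rewrite intrB subrK.
  pose g : F2 R := lg_join (lg_unit *~ k - f *+ N) 0.
  have g0 : germ0 x g.
    have kN : k%:~R < F2_fun (f *+ N) x by rewrite F2_funMn -mulr_natl.
    have := cvgr_gt _ (@F2_continuous _ (f *+ N) x) _ kN.
    move=> hnear; near=> u.
    have hu : k%:~R < F2_fun (f *+ N) u by near: u; exact: hnear.
    rewrite F2_funU F2_funB F2_funMz F2_fun1 F2_fun0 mulr1.
    by apply: max_r; rewrite subr_le0 ltW.
  have [_ hU _ _] := hh.
  have : (h g : R) = Num.max (k%:~R - (h f : R) *+ N) 0.
    rewrite /g hU (ulhomB hh) (ulhomMn _ hh) (ulhom0 hh).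
    have e := ulhom_realMz k hh.
    change (Num.max ((h (lg_unit *~ k) : R) - (h f : R) *+ N) 0
            = Num.max (k%:~R - (h f : R) *+ N) 0).
    by rewrite e.
  rewrite (h0 _ g0) => E.
  have : k%:~R - (h f : R) *+ N <= 0.
    by rewrite [leRHS]E le_max lexx.
  rewrite -mulr_natl; move: hN k2; rewrite mulrBr; lra.
move=> f; apply/eqP; rewrite eq_le lower andbT.
have := lower (- f); rewrite (ulhomN hh) F2_funN.
by change (- F2_fun f x <= - (h f : R) -> (h f : R) <= F2_fun f x); rewrite lerN2.
Unshelve. all: by end_near. Qed.

(** The group generated by 1 and the two coordinates of z. *)
Definition span (z : R * R) : set R := [set r | exists p, r = affine_int p z].

Lemma range_ev x : range (ev x) = span (set_val x).
Proof.
apply/seteqP; split=> r.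
  by case=> f _ <-; have [s /(_ x) [p _ fp]] := F2_piecewise f; exists p.
by case=> p ->; exists (aff R p).
Qed.

Lemma germ0_ideal_at m x f : ideal_set m = ideal_at x -> germ0 x f ->
  ideal_set m f.
Proof. by move=> -> /germ0_ev. Qed.

Lemma quotient_ev m x : ideal_set m = ideal_at x ->
  exists e : quotient m -> real_ulgroup R,
    [/\ is_ulhom e, injective e & forall f, e (qpi m f) = ev x f].
Proof.
move=> mx; have [e he eE] : exists2 e : quotient m -> real_ulgroup R,
    is_ulhom e & forall f, e (qpi m f) = ev x f.
  by apply: quotient_factor; [exact: ev_hom | rewrite mx].
exists e; split=> // X Y; have [f <-] := qpi_surj X; have [g <-] := qpi_surj Y.
rewrite !eE => fg; apply/qpiE; rewrite mx; change (F2_fun f x - F2_fun g x = 0).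
by apply/eqP; rewrite subr_eq0; apply/eqP.
Qed.

Lemma holder_groupE m x : ideal_set m = ideal_at x ->
  holder_group (R := R) m = span (set_val x).
Proof.
move=> mx; rewrite -range_ev; apply/seteqP; split=> r.
  case=> e [he _ [X _ <-]]; have [f <-] := qpi_surj X.
  exists f => //; symmetry.
  apply: (ev_unique (ulhom_comp (qpi_hom m) he)) => g /(germ0_ideal_at mx).
  by rewrite /= => /qpi_eq0 ->; exact: ulhom0.
case=> f _ <-; have [e [he inj_e eE]] := quotient_ev mx.
by exists e; split=> //; exists (qpi m f).
Qed.

(** Evaluation at y composed with k is a unital homomorphism that kills the
    functions vanishing near x, hence it is evaluation at x. *)
Lemma iso_span_sub x y m n : ideal_set n = ideal_at y ->
  (forall f, germ0 x f -> ideal_set m f) ->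
  forall k : quotient m -> quotient n, is_ulhom k ->
  span (set_val x) `<=` span (set_val y).
Proof.
move=> ny germm k hk; have [e [he _ eE]] := quotient_ev ny.
have hc := ulhom_comp (ulhom_comp (qpi_hom m) hk) he.
have hE := ev_unique hc.
move=> r [p ->]; rewrite -range_ev.
have [f kf] := qpi_surj (k (qpi m (aff R p))).
exists f => //; rewrite -eE kf; apply: hE => g /germm /qpi_eq0 /= ->.
by rewrite (ulhom0 hk) (ulhom0 he).
Qed.

End Points.

(** * Germinal and maximal ideals *)

Section IdealsOfPoints.
Variable R : realType.
Implicit Types (f g : F2 R) (u x y : unit_square R) (p q : int * int * int).
Implicit Types (m n : ideal (F2 R)).

Lemma iso_of_ranges (G H : ulgroupType) (e : G -> real_ulgroup R)
    (e' : H -> real_ulgroup R) :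
  is_ulhom e -> injective e -> is_ulhom e' -> injective e' ->
  range e = range e' -> ul_iso G H.
Proof.
move=> he inj_e he' inj_e' ee'.
have ex_k X : exists Y, e' Y = e X.
  have : range e' (e X) by rewrite -ee'; exists X.
  by case=> Y _; exists Y.
have ex_k' Y : exists X, e X = e' Y.
  have : range e (e' Y) by rewrite ee'; exists Y.
  by case=> X _; exists X.
pose k X := projT1 (cid (ex_k X)); pose k' Y := projT1 (cid (ex_k' Y)).
have kE X : e' (k X) = e X := projT2 (cid (ex_k X)).
have k'E Y : e (k' Y) = e' Y := projT2 (cid (ex_k' Y)).
have [eD eU eI e1] := he; have [eD' eU' eI' e1'] := he'.
exists k; split; last first.
  exists k' => X; first by apply: inj_e; rewrite k'E kE.
  by apply: inj_e'; rewrite kE k'E.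
split; last by apply: inj_e'; rewrite kE e1 e1'.
- by move=> X Y; apply: inj_e'; rewrite eD' !kE eD.
- by move=> X Y; apply: inj_e'; rewrite eU' !kE eU.
- by move=> X Y; apply: inj_e'; rewrite eI' !kE eI.
Qed.

(** Each quotient is embedded in the reals by evaluation, and a unital
    homomorphism between two such subgroups can only be an inclusion. *)
Lemma quotient_isoP x y m n : ideal_set m = ideal_at x ->
  ideal_set n = ideal_at y ->
  ul_iso (quotient m) (quotient n) <-> span (set_val x) = span (set_val y).
Proof.
move=> mx ny; split=> [mn|xy].
  have half x' y' m' n' : ideal_set m' = ideal_at x' ->
      ideal_set n' = ideal_at y' -> ul_iso (quotient m') (quotient n') ->
      span (set_val x') `<=` span (set_val y').
    move=> mx' ny' [k [hk _]].
    exact: (iso_span_sub ny' (fun f => @germ0_ideal_at _ m' x' f mx') hk).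
  apply/seteqP; split; first exact: (half _ _ _ _ mx ny mn).
exact: (half _ _ _ _ ny mx (ul_iso_sym mn)).
have [e [he inj_e eE]] := quotient_ev mx.
have [e' [he' inj_e' eE']] := quotient_ev ny.
have rng m' x' (e0 : quotient m' -> real_ulgroup R) :
    (forall f, e0 (qpi m' f) = ev x' f) -> range e0 = span (set_val x').
  move=> e0E; rewrite -range_ev; apply/seteqP; split=> r.
    by case=> X _ <-; have [f <-] := qpi_surj X; exists f.
  by case=> f _ <-; exists (qpi m' f).
apply: (iso_of_ranges he inj_e he' inj_e').
by rewrite (rng _ _ _ eE) (rng _ _ _ eE').
Qed.

Section UltraIdeal.
Variables (V : set_system (unit_square R)) (VU : UltraFilter V).

(** The kernel of the map from F2 to the ultrapower of the reals along V; the
    ultrapower is totally ordered, so this is a prime ideal. *)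
Definition ultra_zero : set (F2 R) := [set f | V [set u | F2_fun f u = 0]].

Lemma ultra_zero_congr : lcongruence ultra_zero.
Proof.
split; rewrite /ultra_zero.
- exact: filterE.
- move=> f g; apply: filterS2 => u /= fu gu.
  by change (F2_fun f u - F2_fun g u = 0); rewrite fu gu subrr.
- move=> h f g; apply: filterS => u /= /eqP; rewrite subr_eq0 => /eqP fg.
  change (Num.max (F2_fun f u) (F2_fun h u) -
          Num.max (F2_fun g u) (F2_fun h u) = 0).
  by rewrite fg subrr.
- move=> h f g; apply: filterS => u /= /eqP; rewrite subr_eq0 => /eqP fg.
  change (Num.min (F2_fun f u) (F2_fun h u) -
          Num.min (F2_fun g u) (F2_fun h u) = 0).
  by rewrite fg subrr.
Qed.

Definition ultra_ideal : ideal (F2 R) := Ideal (congr_idealP ultra_zero_congr).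

Lemma ultra_idealE f g : qpi ultra_ideal f = qpi ultra_ideal g <->
  V [set u | F2_fun f u = F2_fun g u].
Proof.
rewrite qpiE; split; apply: filterS => u /= /eqP.
  by rewrite subr_eq0 => /eqP.
by rewrite -subr_eq0 => /eqP.
Qed.

Lemma ultra_le f g : V [set u | F2_fun f u <= F2_fun g u] ->
  qpi ultra_ideal f <= qpi ultra_ideal g.
Proof.
move=> fg; have -> : qpi ultra_ideal g = qpi ultra_ideal (lg_join f g).
  by apply/ultra_idealE; apply: filterS fg => u /= h; rewrite max_r.
have [_ -> _ _] := qpi_hom ultra_ideal; exact: lg_leUl.
Qed.

Lemma ultra_total (X Y : quotient ultra_ideal) : X <= Y \/ Y <= X.
Proof.
have [f <-] := qpi_surj X; have [g <-] := qpi_surj Y.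
have [fg|gf] := in_ultra_setVsetC [set u | F2_fun f u <= F2_fun g u] VU.
  by left; exact: ultra_le.
right; apply: ultra_le; apply: filterS gf => u /= /negP.
by rewrite -ltNge => /ltW.
Qed.

Lemma ultra_prime : prime_ideal ultra_ideal.
Proof.
exists (quotient ultra_ideal), (qpi ultra_ideal); split.
- exact: qpi_hom.
- apply/seteqP; split=> f; first by move/(qpi_eq0 ultra_ideal f).
  by move=> f0; apply/(qpi_eq0 ultra_ideal f).
- by move=> f g; exact: ultra_total.
Qed.

Lemma ultra_limit x f g : nbhs x `<=` V ->
  V [set u | F2_fun f u = F2_fun g u] -> F2_fun f x = F2_fun g x.
Proof.
move=> xV fg; apply/eqP; apply: contraT => neq.
have neq0 : F2_fun (f - g) x != 0 by rewrite F2_funB subr_eq0.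
have Vn : V [set u | F2_fun (f - g) u != 0].
  exact: (xV _ (cvgr_neq0 _ (@F2_continuous _ (f - g) x) neq0)).
have [u [/= + fgu]] := filter_ex (filterI Vn fg).
by rewrite fgu subrr eqxx.
Qed.

End UltraIdeal.

(** An integral bump function: rational approximations of the coordinates
    replace the possibly irrational centre. *)
Lemma bump_function x (e : R) : 0 < e -> exists g : F2 R,
  [/\ 0 <= g, F2_fun g x != 0 & forall u, F2_fun g u != 0 ->
      `|(set_val u).1 - (set_val x).1| < e /\
      `|(set_val u).2 - (set_val x).2| < e].
Proof.
move=> e0; pose N := Num.bound (2 / e).
(* g is supported in a box of radius at most 2/N around x *)
have hN : 2 < N%:R * e.
  by rewrite -ltr_pdivrMr //; apply: archi_boundP; rewrite divr_ge0 // ltW.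
have N0 : 0 < N%:R :> R by rewrite -(pmulr_lgt0 _ e0); apply: lt_trans hN.
pose a := Num.floor (N%:R * (set_val x).1).
pose b := Num.floor (N%:R * (set_val x).2).
have /andP[a1 a2] : a%:~R <= N%:R * (set_val x).1 < a%:~R + 1.
  by have := floor_itv (N%:R * (set_val x).1); rewrite intrD.
have /andP[b1 b2] : b%:~R <= N%:R * (set_val x).2 < b%:~R + 1.
  by have := floor_itv (N%:R * (set_val x).2); rewrite intrD.
pose t1 := aff R (N%:Z, 0, 1 - a); pose t2 := aff R (- N%:Z, 0, a + 2).
pose t3 := aff R (0, N%:Z, 1 - b); pose t4 := aff R (0, - N%:Z, b + 2).
have t1E u : F2_fun t1 u = N%:R * (set_val u).1 - a%:~R + 1.
  by rewrite affE /affine_int /= !intrB -pmulrn; ring.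
have t2E u : F2_fun t2 u = a%:~R + 2 - N%:R * (set_val u).1.
  by rewrite affE /affine_int /= mulrNz intrD -pmulrn; ring.
have t3E u : F2_fun t3 u = N%:R * (set_val u).2 - b%:~R + 1.
  by rewrite affE /affine_int /= !intrB -pmulrn; ring.
have t4E u : F2_fun t4 u = b%:~R + 2 - N%:R * (set_val u).2.
  by rewrite affE /affine_int /= mulrNz intrD -pmulrn; ring.
exists (lg_join 0 (lg_meet (lg_meet t1 t2) (lg_meet t3 t4))); split.
- exact: lg_leUl.
- rewrite F2_funU !F2_funI F2_fun0 t1E t2E t3E t4E.
  by rewrite gt_eqF // lt_max !lt_min; apply/orP; right; lra.
move=> u; rewrite F2_funU !F2_funI F2_fun0 t1E t2E t3E t4E => nz.
have : 0 < Num.min (Num.min (N%:R * (set_val u).1 - a%:~R + 1)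
    (a%:~R + 2 - N%:R * (set_val u).1))
   (Num.min (N%:R * (set_val u).2 - b%:~R + 1)
    (b%:~R + 2 - N%:R * (set_val u).2)).
  by rewrite ltNge; apply: contraNN nz => ?; rewrite max_l.
rewrite !lt_min => /andP[/andP[c1 c2] /andP[c3 c4]].
by split; rewrite -(ltr_pM2l N0) -[N%:R in ltLHS]ger0_norm ?ltW // -normrM
  ltr_norml; lra.
Qed.

(** If f does not vanish near x, then an ultrafilter converging to x on which
    f has no zeros gives a prime ideal inside the maximal ideal that omits f.
    Conversely, if f vanishes near x, its absolute value is disjoint from a bump
    function that is nonzero at x, and a prime ideal contains one of two
    disjoint elements. *)
Lemma germinal_setE m x : ideal_set m = ideal_at x ->
  germinal_set m = [set f | germ0 x f].
Proof.
move=> mx; apply/seteqP; split=> f.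
  move=> gf; apply: contrapT => ngf.
  pose B := within [set u | F2_fun f u != 0] (nbhs x).
  have PB : ProperFilter B.
    apply: Build_ProperFilter_ex => A; rewrite /B /within /= => hA.
    apply: contrapT => /forallNP nA; apply: ngf.
    apply: filterS hA => u hu; apply/eqP; apply: contraT => fu.
    by case: (nA u); exact: hu.
  have [V [VU BV]] := ultraFilterLemma PB.
  have xV : nbhs x `<=` V.
    by move=> A xA; apply: BV; apply: filterS xA.
  have Vf : ultra_zero V f.
    apply: (gf (ultra_ideal VU) (ultra_prime VU)) => g Vg.
    rewrite mx /ideal_at /=.
    by apply: (ultra_limit VU (g := 0) xV).
  have Vn : V [set u | F2_fun f u != 0] by apply: BV; exact: withinT.
  have [u [/= + fu0]] := filter_ex (filterI Vn Vf).
  by rewrite fu0 eqxx.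
move=> gf P [H [k [hk Pk tot]] Pm].
have [e e0 he] := nbhs_box gf.
have [g [g0 gx gu]] := bump_function x e0.
have gf0 : lg_meet g (lg_abs f) = 0.
  apply: F2P => u; rewrite F2_funI F2_fun_abs F2_fun0.
  have gu0 : 0 <= F2_fun g u by move/F2_leP: g0 => /(_ u).
  have [guz|/gu[u1 u2]] := eqVneq (F2_fun g u) 0.
    by rewrite guz min_l.
  by rewrite (he u u1 u2) normr0 min_r.
have : ideal_set P (lg_abs f).
  rewrite Pk /hom_kernel /=; have [_ _ kI _] := hk.
  have : k (lg_meet g (lg_abs f)) = 0 by rewrite gf0 (ulhom0 hk).
  rewrite kI; case: (tot g (lg_abs f)) => [gle|fle]; last by rewrite lg_meet_r.
  rewrite lg_meet_l // => kg; have : ideal_set P g by rewrite Pk.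
  by move/Pm; rewrite mx /ideal_at /= => gx0; rewrite gx0 eqxx in gx.
by move=> Pf; apply/ideal_abs.
Qed.

Lemma germinal_idealE m x f : ideal_set m = ideal_at x ->
  ideal_set (germinal_ideal m) f <-> germ0 x f.
Proof. by move=> mx; rewrite /germinal_ideal /= (germinal_setE mx). Qed.

Lemma germinal_iso_span x y m n : ideal_set m = ideal_at x ->
  ideal_set n = ideal_at y ->
  ul_iso (quotient (germinal_ideal m)) (quotient (germinal_ideal n)) ->
  span (set_val x) = span (set_val y).
Proof.
move=> mx ny mn.
have half x' y' m' n' : ideal_set m' = ideal_at x' ->
    ideal_set n' = ideal_at y' ->
    ul_iso (quotient (germinal_ideal m')) (quotient (germinal_ideal n')) ->
    span (set_val x') `<=` span (set_val y').
  move=> mx' ny' [k [hk _]].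
  have [q hq qE] : exists2 q : quotient (germinal_ideal n') -> quotient n',
      is_ulhom q & forall f, q (qpi _ f) = qpi n' f.
    apply: quotient_factor; first exact: qpi_hom.
    move=> f /(germinal_idealE f ny') /(germ0_ideal_at ny').
    by move/qpi_eq0.
  apply: (iso_span_sub ny' _ (ulhom_comp hk hq)) => f.
  by move/(germinal_idealE f mx').
apply/seteqP; split; first exact: (half _ _ _ _ mx ny mn).
exact: (half _ _ _ _ ny mx (ul_iso_sym mn)).
Qed.

Lemma ideal_at_proper m x : ideal_set m `<=` ideal_at x -> ideal_set m <> setT.
Proof.
move=> mx mT; have /mx : ideal_set m lg_unit by rewrite mT.
by rewrite /ideal_at /= => /eqP; rewrite oner_eq0.
Qed.

Lemma ideal_at_maximal m x : ideal_set m = ideal_at x -> maximal_ideal m.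
Proof.
move=> mx; split; first by apply: (@ideal_at_proper _ x); rewrite mx.
move=> J mJ JT; apply/seteqP; split=> // f Jf; rewrite mx /ideal_at /=.
apply/eqP; apply: contraT => fx; exfalso; apply: JT; apply: ideal_unit.
pose N := Num.bound (1 / `|F2_fun f x|).
have hN : 1 < N%:R * `|F2_fun f x|.
  rewrite -ltr_pdivrMr ?normr_gt0 //; apply: archi_boundP.
  by rewrite divr_ge0.
pose g : F2 R := lg_meet (lg_abs f *+ N) lg_unit.
have Jg : ideal_set J g.
  apply: (@ideal_convex _ _ _ (lg_abs f *+ N)).
  - apply/F2_leP => u; rewrite F2_funI F2_funMn F2_fun_abs F2_fun1 F2_fun0.
    rewrite le_min ler01 andbT; apply: mulrn_wge0; exact: normr_ge0.
  - by apply/F2_leP => u; rewrite F2_funI ge_min lexx.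
  - by apply: idealMn; apply/(ideal_abs J f).
have -> : lg_unit = g + (lg_unit - g) by rewrite addrC subrK.
apply: idealD => //; apply: mJ; rewrite mx.
change (1 - F2_fun g x = 0).
rewrite F2_funI F2_funMn F2_fun_abs F2_fun1 -mulr_natl min_r ?subrr //.
exact: ltW.
Qed.

End IdealsOfPoints.

Section MaximalIdeals.
Variable R : realType.
Implicit Types (f g : F2 R) (u x y : unit_square R) (n : ideal (F2 R)).

Lemma unit_square_compact : compact (unit_square R).
Proof.
have -> : unit_square R = `[0, 1]%classic `*` `[0, 1]%classic.
  by apply/seteqP; split=> -[a b]; rewrite /unit_square /= !in_itv.
by apply: compact_setX; exact: segment_compact.
Qed.

(** A multiple of |f| exceeds the unit if f is bounded away from 0, so each
    member of a proper ideal takes arbitrarily small values. The sets where a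
    member is small therefore generate a filter, and by compactness it has a
    cluster point, which is a common zero. *)
Lemma proper_ideal_zero n : ideal_set n <> setT ->
  exists y, ideal_set n `<=` ideal_at y.
Proof.
move=> nT.
pose F : set_system (R * R) := [set B | exists f, exists e : R,
  [/\ ideal_set n f, 0 < e & forall u, `|F2_fun f u| < e -> B (set_val u)]].
have FF : Filter F.
  split.
  - exists 0, 1; split=> //; apply/(qpi_eq0 n).
    exact: (ulhom0 (qpi_hom n)).
  - move=> A B [f [e [nf e0 fA]]] [g [d [ng d0 gB]]].
    exists (lg_abs f + lg_abs g), (Num.min e d); split.
    + by apply: idealD; [apply/(ideal_abs n f) | apply/(ideal_abs n g)].
    + by rewrite lt_min e0.
    + move=> u; rewrite F2_funD !F2_fun_abs lt_min.
      have := normr_ge0 (F2_fun f u); have := normr_ge0 (F2_fun g u).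
      rewrite [`|_ + _|]ger0_norm ?addr_ge0 // => h1 h2 /andP[h3 h4].
      by split; [apply: fA | apply: gB]; lra.
  - move=> A B AB [f [e [nf e0 fA]]]; exists f, e; split=> // u /fA.
    exact: AB.
have PF : ProperFilter F.
  apply: Build_ProperFilter_ex => A [f [e [nf e0 fA]]].
  apply: contrapT => /forallNP nA; apply: nT; apply: ideal_unit.
  pose N := Num.bound (1 / e).
  have hN : 1 < N%:R * e.
    by rewrite -ltr_pdivrMr //; apply: archi_boundP; rewrite divr_ge0 // ltW.
  apply: (@ideal_convex _ _ _ (lg_abs f *+ N)).
  - by apply/F2_leP => u; rewrite F2_fun1 F2_fun0.
  - apply/F2_leP => u; rewrite F2_fun1 F2_funMn F2_fun_abs -mulr_natl.
    apply: (le_trans (ltW hN)); rewrite ler_wpM2l // leNgt; apply/negP => h.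
    by apply: (nA (set_val u)); apply: fA.
  - by apply: idealMn; apply/(ideal_abs n f).
have Fsq : F (unit_square R).
  exists 0, 1; split=> //; last by move=> u _; exact: set_valP.
  by apply/(qpi_eq0 n); exact: (ulhom0 (qpi_hom n)).
have [z [zsq zF]] := unit_square_compact PF Fsq.
pose y : unit_square R := SigSub (mem_set zsq).
exists y => f nf; apply/eqP; apply: contraT => fy.
have e0 : 0 < `|F2_fun f y| / 2 by rewrite divr_gt0 // normr_gt0.
have /cvgrPdist_lt /(_ _ e0) /nbhs_box[d d0 hd] := @F2_continuous _ f y.
have FA : F [set w | exists2 u, set_val u = w & `|F2_fun f u| < `|F2_fun f y| / 2].
  by exists f, (`|F2_fun f y| / 2); split=> // u hu; exists u.
have [_ [[u <- fu] [/= u1 u2]]] := zF _ _ FA (nbhsx_ballx z _ d0).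
have := hd u; rewrite distrC => /(_ u1); rewrite distrC => /(_ u2) /= hu.
have := lerB_dist (F2_fun f y) (F2_fun f u).
lra.
Qed.

Lemma maximal_ideal_at n : maximal_ideal n ->
  exists y, ideal_set n = ideal_at y.
Proof.
case=> nT nmax; have [y ny] := proper_ideal_zero nT; exists y.
rewrite -maxidE; symmetry; apply: nmax => //.
exact: (@ideal_at_proper _ _ y).
Qed.

End MaximalIdeals.

(** * Integral affine equivalence of points *)

Section AffineEquivalence.
Variable R : realType.
Implicit Types (f g : F2 R) (u x y : unit_square R) (z w : R * R).
Implicit Types (p : int * int * int) (P Q : (int * int * int) * (int * int * int)).

Definition affine_map P z : R * R := (affine_int P.1 z, affine_int P.2 z).

(** The coefficients of the composite of the form p with the map P. *)
Definition affine_subst p P : int * int * int :=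
  scale_int p.1.1 P.1 + scale_int p.1.2 P.2 + (0, 0, p.2).

Lemma affine_substE p P z :
  affine_int (affine_subst p P) z = affine_int p (affine_map P z).
Proof.
rewrite /affine_subst !affine_intD !affine_int_scale /affine_map.
by rewrite /affine_int /=; ring.
Qed.

(** Equivalence under the affine group of the integer lattice, the semidirect
    product of GL(2,Z) and Z^2. *)
Definition affine_equiv z w : Prop := exists P Q,
  [/\ cancel (affine_map P) (affine_map Q),
      cancel (affine_map Q) (affine_map P) & affine_map P z = w].

Lemma affine_equiv_sym z w : affine_equiv z w -> affine_equiv w z.
Proof.
by case=> P [Q [PK QK zw]]; exists Q, P; split=> //; rewrite -zw PK.
Qed.

Lemma affine_map_comp P Q z :
  affine_map (affine_subst P.1 Q, affine_subst P.2 Q) z =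
  affine_map P (affine_map Q z).
Proof. by rewrite /affine_map /= !affine_substE. Qed.

Lemma affine_equiv_trans z w t :
  affine_equiv z w -> affine_equiv w t -> affine_equiv z t.
Proof.
case=> P [Q [PK QK zw]] [P' [Q' [PK' QK' wt]]].
exists (affine_subst P'.1 P, affine_subst P'.2 P).
exists (affine_subst Q.1 Q', affine_subst Q.2 Q'); split.
- by move=> v; rewrite !affine_map_comp PK' PK.
- by move=> v; rewrite !affine_map_comp QK QK'.
- by rewrite affine_map_comp zw.
Qed.

Lemma affine_equiv_span z w : affine_equiv z w -> span z = span w.
Proof.
have half z' w' : affine_equiv z' w' -> span z' `<=` span w'.
  case=> P [Q [PK _ <-]] _ [p ->]; exists (affine_subst p Q).
  by rewrite affine_substE PK.
by move=> zw; apply/seteqP; split; apply: half => //; exact: affine_equiv_sym.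
Qed.

(** Since the determinant d is its own inverse, the inverse matrix is d times
    the adjugate. *)
Lemma affine_equiv_unimodular (a b c e s t d : int) z :
  a * e - b * c = d -> d * d = 1 ->
  affine_equiv z (a%:~R * z.1 + b%:~R * z.2 + s%:~R,
                  c%:~R * z.1 + e%:~R * z.2 + t%:~R).
Proof.
move=> /(congr1 (fun k => k%:~R : R)) + /(congr1 (fun k => k%:~R : R)).
rewrite intrB !intrM => ad dd.
exists ((a, b, s), (c, e, t)).
exists ((d * e, - (d * b), d * (b * t - e * s)),
        (- (d * c), d * a, d * (c * s - a * t))).
have d1 : d%:~R * d%:~R - 1 = 0 :> R by rewrite dd subrr.
split=> //; move=> [v1 v2]; rewrite /affine_map /affine_int /=.
  rewrite !(intrM, intrB, mulrNz); congr pair.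
    transitivity (v1 + v1 * (d%:~R * d%:~R - 1)); first by rewrite -ad; ring.
    by rewrite d1 mulr0 addr0.
  transitivity (v2 + v2 * (d%:~R * d%:~R - 1)); first by rewrite -ad; ring.
  by rewrite d1 mulr0 addr0.
rewrite !(intrM, intrB, mulrNz); congr pair.
  transitivity (v1 + (v1 - s%:~R) * (d%:~R * d%:~R - 1)).
    by rewrite -ad; ring.
  by rewrite d1 mulr0 addr0.
transitivity (v2 + (v2 - t%:~R) * (d%:~R * d%:~R - 1)).
  by rewrite -ad; ring.
by rewrite d1 mulr0 addr0.
Qed.

End AffineEquivalence.

Section Substitution.
Variable R : realType.
Implicit Types (f g : F2 R) (u v x y : unit_square R) (z w : R * R).
Implicit Types (p : int * int * int) (P Q : (int * int * int) * (int * int * int)).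

Definition clamp f : F2 R := lg_meet (lg_join f 0) lg_unit.

Lemma clampE f u :
  F2_fun (clamp f) u = Num.min (Num.max (F2_fun f u) 0) 1.
Proof. by []. Qed.

Lemma clamp_bounds f u : 0 <= F2_fun (clamp f) u <= 1.
Proof. by rewrite clampE ge_min lexx orbT le_min ler01 le_max lexx orbT. Qed.

Lemma clamp_id f u : 0 <= F2_fun f u <= 1 -> F2_fun (clamp f) u = F2_fun f u.
Proof. by case/andP => f0 f1; rewrite clampE max_l // min_l. Qed.

(** The affine map P, composed with a retraction onto the square so that it
    acts on the functions on the square. *)
Definition sq_map P u : unit_square R :=
  sqpt (clamp_bounds (aff R P.1) u) (clamp_bounds (aff R P.2) u).

Lemma sq_map_continuous P : continuous (sq_map P).
Proof.
apply: (@continuous_comp_initial _ _ _ (set_val : unit_square R -> R * R)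
  (sq_map P)) => u.
pose c1 := clamp (aff R P.1); pose c2 := clamp (aff R P.2).
have : (F2_fun c1 v, F2_fun c2 v) @[v --> u] --> (F2_fun c1 u, F2_fun c2 u).
  exact: (cvg_pair (@F2_continuous _ c1 u) (@F2_continuous _ c2 u)).
exact.
Qed.

Lemma sq_map_near P x : 0 < (affine_map P (set_val x)).1 < 1 ->
  0 < (affine_map P (set_val x)).2 < 1 ->
  \forall u \near x, set_val (sq_map P u) = affine_map P (set_val u).
Proof.
have near_id p : 0 < F2_fun (aff R p) x < 1 ->
    \forall u \near x, F2_fun (clamp (aff R p)) u = F2_fun (aff R p) u.
  case/andP=> f0 f1; near=> u; apply: clamp_id; apply/andP; split; apply: ltW.
    near: u; exact: (cvgr_gt _ (@F2_continuous _ (aff R p) x) _ f0).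
  near: u; exact: (cvgr_lt _ (@F2_continuous _ (aff R p) x) _ f1).
move=> /near_id h1 /near_id h2; apply: filterS2 h1 h2 => u h1 h2.
by rewrite sqptE h1 h2.
Unshelve. all: by end_near. Qed.

Lemma pullback_subproof P f :
  `[< continuous (fun u => F2_fun f (sq_map P u)) /\
      piecewise_affine_int (fun u => F2_fun f (sq_map P u)) >].
Proof.
apply/asboolP; split.
  move=> u; apply: (@continuous_comp _ _ _ (sq_map P) (F2_fun f)).
    exact: sq_map_continuous.
  exact: F2_continuous.
have [s hs] := F2_piecewise f.
have [t1 ht1] := F2_piecewise (clamp (aff R P.1)).
have [t2 ht2] := F2_piecewise (clamp (aff R P.2)).
exists [seq affine_subst pq.1 pq.2 | pq <- [seq (p, q) | p <- s,
  q <- [seq (q1, q2) | q1 <- t1, q2 <- t2]]] => u.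
have [p ps ->] := hs (sq_map P u).
have [q1 q1t E1] := ht1 u; have [q2 q2t E2] := ht2 u.
exists (affine_subst p (q1, q2)).
  apply/mapP; exists (p, (q1, q2)) => //.
  by apply: allpairs_f => //; apply: allpairs_f.
by rewrite affine_substE sqptE E1 E2.
Qed.

Definition pullback P f : F2 R := MkF2 (pullback_subproof P f).

Lemma pullback_hom P : is_ulhom (pullback P).
Proof. by split=> [f g|f g|f g|]; apply: F2P. Qed.

Definition interior_pt z : Prop := 0 < z.1 < 1 /\ 0 < z.2 < 1.

Lemma sq_map_at P x y : interior_pt (set_val y) ->
  affine_map P (set_val x) = set_val y -> sq_map P x = y.
Proof.
move=> [y1 y2] xy; apply: val_inj; rewrite -[RHS]xy.
have nP : \forall u \near x, set_val (sq_map P u) = affine_map P (set_val u).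
  by apply: sq_map_near; rewrite xy.
exact: (nbhs_singleton nP).
Qed.

Lemma sq_map_cvg P x y : interior_pt (set_val y) ->
  affine_map P (set_val x) = set_val y -> sq_map P u @[u --> x] --> y.
Proof.
by move=> iy xy; rewrite -(sq_map_at iy xy); exact: sq_map_continuous.
Qed.

Lemma germ0_pullback P x y f : interior_pt (set_val y) ->
  affine_map P (set_val x) = set_val y -> germ0 y f -> germ0 x (pullback P f).
Proof.
move=> iy xy fy; apply: (sq_map_cvg iy xy fy).
Qed.

Lemma pullbackK P Q x y f : cancel (@affine_map R P) (@affine_map R Q) ->
  interior_pt (set_val x) -> interior_pt (set_val y) ->
  affine_map P (set_val x) = set_val y ->
  germ0 x (pullback P (pullback Q f) - f).
Proof.
move=> PK ix iy xy; have [x1 x2] := ix; have [y1 y2] := iy.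
have nP : \forall u \near x, set_val (sq_map P u) = affine_map P (set_val u).
  by apply: sq_map_near; rewrite xy.
have nQ : \forall v \near y, set_val (sq_map Q v) = affine_map Q (set_val v).
  by apply: sq_map_near; rewrite -xy PK.
have nPQ := sq_map_cvg iy xy nQ.
apply: filterS2 nP nPQ => u hP hPQ.
suff E : sq_map Q (sq_map P u) = u.
  by change (F2_fun f (sq_map Q (sq_map P u)) - F2_fun f u = 0); rewrite E subrr.
by apply: val_inj; move: hPQ; rewrite /= => hPQ; rewrite [LHS]hPQ hP PK.
Qed.

(** Near an interior point the retraction onto the square is not felt, so the
    pullbacks along an affine map and its inverse are inverse to each other up
    to functions that vanish near the point. *)
Lemma affine_equiv_germinal_iso x y (m n : ideal (F2 R)) :
  ideal_set m = ideal_at x -> ideal_set n = ideal_at y ->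
  interior_pt (set_val x) -> interior_pt (set_val y) ->
  affine_equiv (set_val x) (set_val y) ->
  ul_iso (quotient (germinal_ideal m)) (quotient (germinal_ideal n)).
Proof.
move=> mx ny ix iy [P [Q [PK QK xy]]].
have yx : affine_map Q (set_val y) = set_val x by rewrite -xy PK.
apply: (quotient_iso (pullback_hom Q) (pullback_hom P)) => f.
- move=> /(germinal_idealE f mx) fx; apply/(germinal_idealE _ ny).
  exact: germ0_pullback fx.
- move=> /(germinal_idealE f ny) fy; apply/(germinal_idealE _ mx).
  exact: germ0_pullback fy.
- by apply/(germinal_idealE _ mx); apply: pullbackK xy.
- by apply/(germinal_idealE _ ny); apply: pullbackK yx.
Qed.

End Substitution.

(** * The integral relation as an invariant of germs *)

Section GermInvariant.
Variable R : realType.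
Implicit Types (f g : F2 R) (u v x y : unit_square R) (z w : R * R).
Implicit Types (p q L : int * int * int) (m n : ideal (F2 R)).

(** The pieces of f near x take the value f(x) = 0 at x, and without integral
    relations at x only the zero form does. *)
Lemma germ0_no_relation x f :
  (forall p, affine_int p (set_val x) = 0 -> p = 0) ->
  F2_fun f x = 0 -> germ0 x f.
Proof.
move=> rx fx; have [s [sx]] := local_pieces f x; apply: filterS => u [p ps ->].
by rewrite (rx p) ?affine_int0 // sx.
Qed.

Lemma germinal_ideal_no_relation m x : ideal_set m = ideal_at x ->
  (forall p, affine_int p (set_val x) = 0 -> p = 0) -> germinal_ideal m = m.
Proof.
move=> mx rx; apply: ideal_eq; apply/seteqP; split=> f.
  by move=> /(germinal_idealE f mx); exact: germ0_ideal_at.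
rewrite mx => fx; apply/(germinal_idealE f mx).
exact: germ0_no_relation fx.
Qed.

Lemma ultra_seq (T : eqType) (s : seq T) (A : T -> set (unit_square R))
    (V : set_system (unit_square R)) : UltraFilter V ->
  V [set u | exists2 t, t \in s & A t u] -> exists2 t, t \in s & V (A t).
Proof.
move=> VU; elim: s => [|t s IHs] VA.
  by have [u [? ]] := filter_ex VA.
have [Vt|Vt] := in_ultra_setVsetC (A t) VU; first by exists t; rewrite ?mem_head.
have [|t' ts Vt'] := IHs; last by exists t'; rewrite // inE ts orbT.
apply: filterS2 VA Vt => u [t' + At'] nAt; rewrite inE => /orP[/eqP tt'|ts].
  by case: nAt; rewrite /= -tt'.
by exists t'.
Qed.

Lemma ultra_aff (V : set_system (unit_square R)) (VU : UltraFilter V) y f :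
  nbhs y `<=` V -> exists p, affine_int p (set_val y) = F2_fun f y /\
    qpi (ultra_ideal VU) f = qpi (ultra_ideal VU) (aff R p).
Proof.
move=> yV; have [s [sy near_y]] := local_pieces f y.
have [p ps Vp] := ultra_seq VU (yV _ near_y).
by exists p; split; [exact: sy | apply/ultra_idealE].
Qed.

(** A lattice term that vanishes exactly where f agrees with one of the pieces
    in s, so that homomorphisms transport this alternative; the unit serves as
    the empty infimum. *)
Definition piece_defect f (s : seq (int * int * int)) : F2 R :=
  foldr (fun p g => lg_meet (lg_abs (f - aff R p)) g) lg_unit s.

Lemma piece_defect_cons f p s : piece_defect f (p :: s) =
  lg_meet (lg_abs (f - aff R p)) (piece_defect f s).
Proof. by []. Qed.

Lemma piece_defect_eq0 f s u :
  (exists2 p, p \in s & F2_fun f u = affine_int p (set_val u)) ->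
  F2_fun (piece_defect f s) u = 0.
Proof.
have ge0 t : 0 <= F2_fun (piece_defect f t) u.
  elim: t => [|p t IHt]; first by rewrite F2_fun1.
  by rewrite piece_defect_cons F2_funI F2_fun_abs le_min normr_ge0.
elim: s => [[p]//|p s IHs] [q]; rewrite inE => /orP[/eqP ->|qs] fu.
  by rewrite piece_defect_cons F2_funI F2_fun_abs F2_funB affE fu subrr normr0 min_l.
rewrite piece_defect_cons F2_funI IHs; last by exists q.
by rewrite min_r // F2_fun_abs.
Qed.

(** In a totally ordered image a finite infimum vanishes only if one of its
    terms does. *)
Lemma piece_of_total (T : ulgroupType) (h : F2 R -> T) f s : is_ulhom h ->
  (forall a b : T, a <= b \/ b <= a) -> lg_unit <> 0 :> T ->
  h (piece_defect f s) = 0 -> exists2 p, p \in s & h f = h (aff R p).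
Proof.
move=> hh tot T1; have [_ _ hI h1] := hh.
elim: s => [|p s IHs]; first by rewrite /= h1.
rewrite piece_defect_cons hI.
case: (tot (h (lg_abs (f - aff R p))) (h (piece_defect f s))) => le.
  rewrite lg_meet_l // (ulhom_abs hh) => /lg_abs_eq0.
  rewrite (ulhomB hh) => /eqP; rewrite subr_eq0 => /eqP fp.
  by exists p; rewrite ?mem_head.
rewrite lg_meet_r // => /IHs[q qs fq].
by exists q => //; rewrite inE qs orbT.
Qed.

Lemma aff_scale (k : int) p : aff R (scale_int k p) = aff R p *~ k.
Proof. by apply: F2P => u; rewrite F2_funMz !affE affine_int_scale. Qed.

Lemma aff_shift p (e : int) : aff R (p + (0, 0, e)) = aff R p + lg_unit *~ e.
Proof.
apply: F2P => u; rewrite F2_funD F2_funMz F2_fun1 !affE affine_intD.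
by congr (_ + _); rewrite /affine_int /=; ring.
Qed.

(** Along an ultrafilter converging to y off the line L' = 0, each function
    agrees with a single integral form, and distinct forms stay distinct: two
    forms that agree there differ by a multiple of L'. Through the isomorphism
    this is a totally ordered image [th] of F2 in which, by [piece_of_total],
    a function vanishing at x becomes a multiple of the image of L. The form L'
    is such a multiple and is primitive, which leaves only L' and - L' for the
    image of L; divisibility of L + e by N is then transported. *)
Lemma germinal_iso_relation x y m n L L' :
  ideal_set m = ideal_at x -> ideal_set n = ideal_at y ->
  affine_int L (set_val x) = 0 -> affine_int L' (set_val y) = 0 ->
  (forall p, affine_int p (set_val x) = 0 -> exists k, p = scale_int k L) ->
  (forall p, affine_int p (set_val y) = 0 -> exists k, p = scale_int k L') ->
  (forall A, nbhs y A -> exists2 u, A u & affine_int L' (set_val u) != 0) ->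
  ul_iso (quotient (germinal_ideal m)) (quotient (germinal_ideal n)) ->
  exists2 k : int, k = 1 \/ k = -1 & forall (N e : int) p,
    scale_int N p = L + (0, 0, e) ->
    exists q, scale_int N q = scale_int k L' + (0, 0, e).
Proof.
move=> mx ny Lx Ly genx geny offy [K [hK [K' KK' K'K]]].
pose B := within [set u | affine_int L' (set_val u) != 0] (nbhs y).
have PB : ProperFilter B.
  apply: Build_ProperFilter_ex => A /offy[u Au Lu].
  by exists u; exact: Au.
have [V [VU BV]] := ultraFilterLemma PB.
have yV : nbhs y `<=` V by move=> A yA; apply: BV; apply: filterS yA.
have VL : V [set u | affine_int L' (set_val u) != 0].
  by apply: BV; exact: withinT.
pose T := quotient (ultra_ideal VU); pose pi : F2 R -> T := qpi _.
have hpi : is_ulhom pi := qpi_hom _.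
have pi_inj p q : pi (aff R p) = pi (aff R q) -> p = q.
  move=> /ultra_idealE Vpq; have /= pqy := ultra_limit VU yV Vpq.
  have [|k pq] := geny (p - q); first by rewrite affine_intB pqy subrr.
  have [u [/= pqu Lu]] := filter_ex (filterI Vpq VL).
  have : affine_int (p - q) (set_val u) = 0 by rewrite affine_intB pqu subrr.
  rewrite pq affine_int_scale => /eqP; rewrite mulf_eq0 (negPf Lu) orbF.
  rewrite intr_eq0 => /eqP k0; apply/eqP; rewrite -subr_eq0 pq k0.
  by rewrite /scale_int !mul0r.
have T1 : lg_unit <> 0 :> T.
  have [_ _ _ <-] := hpi; rewrite -(ulhom0 hpi) => /ultra_idealE V10.
  by have [u /= /eqP] := filter_ex V10; rewrite oner_eq0.
have [r hr rE] : exists2 r : quotient (germinal_ideal n) -> T,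
    is_ulhom r & forall f, r (qpi _ f) = pi f.
  apply: (quotient_factor hpi) => f /(germinal_idealE f ny) f0.
  by apply/qpi_eq0; exact: yV.
have [e he eE] : exists2 e : quotient (germinal_ideal n) -> real_ulgroup R,
    is_ulhom e & forall f, e (qpi _ f) = ev y f.
  apply: (quotient_factor (ev_hom y)) => f /(germinal_idealE f ny).
  exact: germ0_ev.
pose q_m := qpi (germinal_ideal m).
have hth : is_ulhom (r \o (K \o q_m)).
  by apply: ulhom_comp hr; apply: ulhom_comp hK; exact: qpi_hom.
pose th f : T := r (K (q_m f)); have {}hth : is_ulhom th := hth.
have evK f : (e (K (q_m f)) : R) = F2_fun f x.
  have hc := ulhom_comp (ulhom_comp (qpi_hom (germinal_ideal m)) hK) he.
  apply: (ev_unique hc) => g /(germinal_idealE g mx) /qpi_eq0 /= ->.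
  by rewrite (ulhom0 hK) (ulhom0 he).
have fwd f : exists2 p, th f = pi (aff R p) &
    affine_int p (set_val y) = F2_fun f x.
  have [f' ff'] := qpi_surj (K (q_m f)).
  have [p [py fp]] := ultra_aff VU f' yV.
  exists p; first by rewrite /th -ff' rE; exact: fp.
  by rewrite py -evK -ff' eE.
have [l rl rly] := fwd (aff R L).
have [j lE] : exists j, l = scale_int j L'.
  by apply: geny; rewrite rly affE.
(* the preimage of L' vanishes at x, so its image is a multiple of that of L *)
have [k kE] : exists k, L' = scale_int k l.
  have [f ff] := qpi_surj (K' (qpi (germinal_ideal n) (aff R L'))).
  have Kf : K (q_m f) = qpi (germinal_ideal n) (aff R L').
    by rewrite /q_m ff K'K.
  have fx : F2_fun f x = 0 by rewrite -evK Kf eE /ev affE.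
  have [s [sx near_x]] := local_pieces f x.
  have g0 : germ0 x (piece_defect f s).
    by apply: filterS near_x => u; exact: piece_defect_eq0.
  have thg : th (piece_defect f s) = 0.
    move: g0 => /(germinal_idealE _ mx) /qpi_eq0; rewrite /th /q_m => ->.
    by rewrite (ulhom0 hK) (ulhom0 hr).
  have [p ps fp] := piece_of_total hth (@ultra_total _ _ VU) T1 thg.
  have [k pk] : exists k, p = scale_int k L by apply: genx; rewrite sx.
  exists k; apply: pi_inj; rewrite aff_scale (ulhomMz _ hpi) -rl.
  by rewrite -(ulhomMz _ hth) -aff_scale -pk -fp /th Kf rE.
have kj : k * j = 1.
  have [u _ Lu] := offy setT filterT.
  apply/eqP; rewrite -(eqr_int R) intrM; apply/eqP; apply: (mulIf Lu).
  by rewrite mul1r -mulrA {2}kE lE !affine_int_scale.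
exists j.
  have : j \is a GRing.unit by apply/unitrP; exists k; rewrite kj mulrC kj.
  by rewrite qualifE /= => /orP[] /eqP; [left | right].
move=> N c p pL; have [q qE _] := fwd (aff R p); exists q; apply: pi_inj.
rewrite -lE aff_shift aff_scale (ulhomMz _ hpi) -qE -(ulhomMz _ hth).
rewrite -aff_scale pL aff_shift; have [-> _ _ th1] := hth.
have [-> _ _ pi1] := hpi.
by rewrite rl (ulhomMz _ hth) (ulhomMz _ hpi) th1 pi1.
Qed.

End GermInvariant.

(** * Ranks and normal forms of points *)

Section Rank.
Variable R : realType.
Implicit Types (z w : R * R) (p : int * int * int).

(** Padded with zero columns to a square matrix, M has determinant 0. *)
Lemma int_left_kernel (k n : nat) (M : 'I_k -> 'I_n -> int) : (n < k)%N ->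
  exists2 c : 'I_k -> int, exists i, c i != 0 &
    forall j, \sum_(i < k) c i * M i j = 0.
Proof.
move=> nk.
pose A := \matrix_(i < k, j < k) (if insub (val j) is Some j' then M i j' else 0).
have /det0P[v v0 vA] : \det A == 0.
  rewrite (expand_det_col A (Ordinal nk)) big1 // => i _.
  by rewrite mxE insubF ?mul0r //= ltnn.
exists (fun i => v 0 i).
  by move/rV0Pn: v0.
move=> j; have /rowP /(_ (widen_ord (ltnW nk) j)) := vA.
rewrite !mxE => E; rewrite -[RHS]E; apply: eq_bigr => i _.
by rewrite mxE /= valK.
Qed.

(** Steinitz exchange over the integers. *)
Lemma Z_independent_leq (k n : nat) (v : 'I_k -> R) (w : 'I_n -> R) :
  Z_independent v ->
  (forall i, exists M : 'I_n -> int, v i = \sum_(j < n) (M j)%:~R * w j) ->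
  (k <= n)%N.
Proof.
move=> vi vw; rewrite leqNgt; apply/negP => nk.
pose M i := projT1 (cid (vw i)).
have ME i : v i = \sum_(j < n) (M i j)%:~R * w j := projT2 (cid (vw i)).
have [c [i ci] cM] := int_left_kernel M nk.
suff : c i = 0 by move=> ci0; rewrite ci0 eqxx in ci.
apply: vi; under eq_bigr do rewrite ME mulr_sumr.
rewrite exchange_big big1 //= => j _.
under eq_bigr do rewrite mulrA -intrM.
by rewrite -mulr_suml -(rmorph_sum intr) /= cM mul0r.
Qed.

Lemma span_rank_le (k : nat) (v : 'I_k -> R) z :
  range v `<=` span z -> Z_independent v -> (k <= 3)%N.
Proof.
move=> vz vi; pose w (j : 'I_3) : R := nth 0 [:: z.1; z.2; 1] j.
apply: (Z_independent_leq (w := w) vi) => i.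
have [|p ->] := vz (v i); first by exists i.
exists (fun j : 'I_3 => nth 0 [:: p.1.1; p.1.2; p.2] j).
by rewrite !big_ord_recl big_ord0 /affine_int /w /=; ring.
Qed.

Lemma span_has_rank z : exists2 r, (r <= 3)%N & has_rank (span z) r.
Proof.
pose P k := `[< exists2 v : 'I_k -> R, range v `<=` span z & Z_independent v >].
have exP : exists k, P k.
  exists 0%N; apply/asboolP; exists (fun=> 0); last by move=> c _ [].
  by move=> t [[i hi]].
have leP k : P k -> (k <= 3)%N by move=> /asboolP[v]; exact: span_rank_le.
have [r /asboolP rP rmax] := ex_maxnP exP leP.
exists r; first by apply: leP; exact/asboolP.
by split=> // k v vz vi; apply: rmax; apply/asboolP; exists v.
Qed.

Lemma span_zmod z : zmod_closed (mem (span z)).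
Proof.
split=> [|r s]; rewrite ?inE.
  by exists 0; rewrite affine_int0.
by move=> [p ->] [q ->]; exists (p - q); rewrite affine_intB.
Qed.

Lemma span1 z : span z 1.
Proof. by exists (0, 0, 1); rewrite /affine_int /=; ring. Qed.

Lemma span_coord1 z : span z z.1.
Proof. by exists (1, 0, 0); rewrite /affine_int /=; ring. Qed.

Lemma span_coord2 z : span z z.2.
Proof. by exists (0, 1, 0); rewrite /affine_int /=; ring. Qed.

Lemma rank2_relation z : has_rank (span z) 2 ->
  exists2 p, p != 0 & affine_int p z = 0.
Proof.
case=> _ rk; apply: contrapT => /forall2NP np.
pose v (j : 'I_3) : R := nth 0 [:: z.1; z.2; 1] j.
suff : (3 <= 2)%N by [].
apply: (rk 3 v).
  move=> _ [[[|[|[|//]]] h] _ <-]; rewrite /v /=.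
  - exact: span_coord1.
  - exact: span_coord2.
  - exact: span1.
move=> c; rewrite !big_ord_recl big_ord0 /v /= => cz.
pose p := (c ord0, c (lift ord0 ord0), c (lift ord0 (lift ord0 ord0))).
have p0 : p = 0.
  apply/eqP; apply: contraT => pn; case: (np p); first by rewrite pn.
  by case; rewrite /affine_int /p /= -[RHS]cz; ring.
case: p0 => c0 c1 c2 [[|[|[|//]]] h].
- by rewrite -[RHS]c0; congr c; apply: val_inj.
- by rewrite -[RHS]c1; congr c; apply: val_inj.
- by rewrite -[RHS]c2; congr c; apply: val_inj.
Qed.

Lemma rank1_rational z t : has_rank (span z) 1 -> span z t ->
  exists q : rat, t = ratr q.
Proof.
case=> _ rk zt; apply: contrapT => /forallNP nq.
pose v (j : 'I_2) : R := nth 0 [:: 1; t] j.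
suff : (2 <= 1)%N by [].
apply: (rk 2 v).
  by move=> _ [[[|[|//]] h] _ <-]; rewrite /v //=; exact: span1.
move=> c; rewrite !big_ord_recl big_ord0 /v /= addr0 mulr1 => cz.
have c1 : c (lift ord0 ord0) = 0.
  apply/eqP; apply: contraT => cn.
  have cn' : (c (lift ord0 ord0))%:~R != 0 :> R by rewrite intr_eq0.
  case: (nq (- (c ord0)%:~R / (c (lift ord0 ord0))%:~R)).
  rewrite fmorph_div rmorphN /= !ratr_int; apply: (mulfI cn').
  by rewrite mulrC [RHS]mulrC divfK //; lra.
have c0 : c ord0 = 0.
  by apply/eqP; move: cz; rewrite c1 mul0r addr0 => /eqP; rewrite intr_eq0.
move=> [[|[|//]] h].
- by rewrite -[RHS]c0; congr c; apply: val_inj.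
- by rewrite -[RHS]c1; congr c; apply: val_inj.
Qed.

End Rank.

Section NormalForms.
Variable R : realType.
Implicit Types (z w : R * R) (p : int * int * int) (q : rat) (c d k : int).

Lemma gcd_cofactors (a b : int) : exists g s t a' b' : int,
  [/\ s * a' + t * b' = 1, a = g * a', b = g * b' &
      g = 0 -> a = 0 /\ b = 0].
Proof.
have [g0|gn0] := eqVneq (gcdz a b) 0.
  have /andP[/eqP -> /eqP ->] : (a == 0) && (b == 0) by rewrite -gcdz_eq0 g0.
  by exists 0, 1, 0, 1, 0; rewrite !mul0r mul1r addr0.
have [s [t st]] := Bezoutz a b.
have /dvdzP[a' aE] := dvdz_gcdl a b; have /dvdzP[b' bE] := dvdz_gcdr a b.
exists (gcdz a b), s, t, a', b'; split.
- apply: (mulIf gn0); rewrite mul1r mulrDl -!mulrA -aE -bE; exact: st.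
- by rewrite mulrC.
- by rewrite mulrC.
- by move=> g0; rewrite g0 eqxx in gn0.
Qed.

Lemma rat_bezout q : exists s t : int, s * numq q + t * denq q = 1.
Proof.
have [s [t st]] := Bezoutz (numq q) (denq q); exists s, t; rewrite st.
by apply/eqP; move: (coprime_num_den q); rewrite /coprime /gcdz => /eqP ->.
Qed.

Lemma denq_neq0R q : (denq q)%:~R != 0 :> R.
Proof. by rewrite intr_eq0 denq_neq0. Qed.

Lemma ratrE q : ratr q * (denq q)%:~R = (numq q)%:~R :> R.
Proof. by rewrite /ratr divfK // denq_neq0R. Qed.

(** A relation a z1 + b z2 + e = 0 says that the primitive integral form
    (a z1 + b z2) / gcd(a, b) takes a rational value; it extends to a basis. *)
Lemma relation_affine_equiv z p : p != 0 -> affine_int p z = 0 ->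
  exists q t, affine_equiv z (ratr q, t).
Proof.
case: p => -[a b] e pn; rewrite /affine_int /= => pz.
have [g [s [t [a' [b' [st aE bE g0]]]]]] := gcd_cofactors a b.
have gn : g != 0.
  apply: contraNneq pn => /g0[a0 b0]; move: pz.
  by rewrite a0 b0 !mul0r !add0r => /eqP; rewrite intr_eq0 => /eqP ->.
have gnR : g%:~R != 0 :> R by rewrite intr_eq0.
exists (- e%:~R / g%:~R), ((- t)%:~R * z.1 + s%:~R * z.2 + 0%:~R).
have -> : ratr (- e%:~R / g%:~R) = a'%:~R * z.1 + b'%:~R * z.2 + 0%:~R :> R.
  rewrite fmorph_div rmorphN /= !ratr_int addr0; apply: (mulIf gnR).
  rewrite divfK //; move: pz; rewrite aE bE !intrM; lra.
apply: (@affine_equiv_unimodular _ _ _ _ _ _ _ 1); last by [].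
by rewrite -st; ring.
Qed.

(** A Bezout matrix moves the point to (c/d, 0) in lowest terms; a shear with
    coefficients i c + j d = 1 produces 1/d in the second coordinate, and
    subtracting c times it clears the first one. *)
Lemma rational_affine_equiv (a b : rat) : exists2 d : int, 0 < d &
  affine_equiv (ratr a, ratr b) (0, d%:~R^-1 : R).
Proof.
pose D := denq a * denq b.
have Dn : D%:~R != 0 :> R by rewrite intrM mulf_neq0 // denq_neq0R.
pose A := numq a * denq b; pose B := numq b * denq a.
have aE : ratr a = A%:~R / D%:~R :> R.
  by apply: (mulIf Dn); rewrite divfK // !intrM mulrA ratrE.
have bE : ratr b = B%:~R / D%:~R :> R.
  by apply: (mulIf Dn); rewrite divfK // !intrM mulrCA ratrE mulrC.
clearbody D A B.
have [g [s [t [a' [b' [st AE BE _]]]]]] := gcd_cofactors A B.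
pose q : rat := g%:~R / D%:~R.
have qD : ratr q = g%:~R / D%:~R :> R by rewrite fmorph_div /= !ratr_int.
have [i [j ij]] := rat_bezout q.
have ijR : i%:~R * (numq q)%:~R + j%:~R * (denq q)%:~R = 1 :> R.
  by rewrite -!intrM -intrD ij.
exists (denq q); first exact: denq_gt0.
apply: (@affine_equiv_trans _ _ (ratr q, 0)).
  have -> : (ratr q, 0) = (s%:~R * ratr a + t%:~R * ratr b + 0%:~R,
      (- b')%:~R * ratr a + a'%:~R * ratr b + 0%:~R) :> R * R.
    have stR : s%:~R * a'%:~R + t%:~R * b'%:~R = 1 :> R.
      by rewrite -!intrM -intrD st.
    rewrite aE bE qD AE BE !intrM; congr pair; last by rewrite mulrNz; ring.
    transitivity (g%:~R / D%:~R * (s%:~R * a'%:~R + t%:~R * b'%:~R) : R).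
      by rewrite stR mulr1.
    by ring.
  apply: (@affine_equiv_unimodular _ _ _ _ _ _ _ 1); last by [].
  by rewrite -st; ring.
apply: (@affine_equiv_trans _ _ (ratr q, (denq q)%:~R^-1)).
  have -> : (ratr q, (denq q)%:~R^-1) = (1%:~R * ratr q + 0%:~R * 0 + 0%:~R,
      i%:~R * ratr q + 1%:~R * 0 + j%:~R) :> R * R.
    congr pair; first by ring.
    apply: (mulIf (denq_neq0R q)); rewrite mulVf ?denq_neq0R //.
    by rewrite -[LHS]ijR -ratrE; ring.
  by apply: (@affine_equiv_unimodular _ _ _ _ _ _ _ 1); ring.
have -> : (0, (denq q)%:~R^-1) =
    (1%:~R * ratr q + (- numq q)%:~R * (denq q)%:~R^-1 + 0%:~R,
     0%:~R * ratr q + 1%:~R * (denq q)%:~R^-1 + 0%:~R) :> R * R.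
  by congr pair; rewrite ?mulrNz /ratr; ring.
by apply: (@affine_equiv_unimodular _ _ _ _ _ _ _ 1); ring.
Qed.

Definition irrational_R (t : R) : Prop :=
  forall i j : int, i%:~R + j%:~R * t = 0 -> j = 0.

Lemma span_normal_form q (t r : R) : span (ratr q, t) r <->
  exists i j : int, r = i%:~R / (denq q)%:~R + j%:~R * t.
Proof.
have dn := denq_neq0R q; split=> [[p ->]|[i [j ->]]].
  exists (p.1.1 * numq q + p.2 * denq q), p.1.2.
  rewrite intrD !intrM /affine_int /= -ratrE; apply: (mulIf dn).
  by rewrite [in RHS]mulrDl divfK //; ring.
have [s [u su]] := rat_bezout q.
exists (i * s, j, i * u); rewrite /affine_int /= !intrM; apply: (mulIf dn).
rewrite [in LHS]mulrDl divfK //.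
have suR : s%:~R * (numq q)%:~R + u%:~R * (denq q)%:~R = 1 :> R.
  by rewrite -!intrM -intrD su.
transitivity (i%:~R * (s%:~R * (numq q)%:~R + u%:~R * (denq q)%:~R) +
  j%:~R * t * (denq q)%:~R : R); first by rewrite suR mulr1.
by rewrite -ratrE; ring.
Qed.

End NormalForms.

Section RankNormalForms.
Variable R : realType.
Implicit Types (z w : R * R) (p : int * int * int) (q : rat) (c d k : int).

(** A relation would put z in normal form, where the group is generated by the
    two elements 1/d and t. *)
Lemma rank3_no_relation z : has_rank (span z) 3 ->
  forall p, affine_int p z = 0 -> p = 0.
Proof.
case=> -[v vz vi] _ p pz; apply/eqP; apply: contraT => pn.
have [q [t zqt]] := relation_affine_equiv pn pz.
pose w (j : 'I_2) : R := nth 0 [:: (denq q)%:~R^-1; t] j.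
suff : (3 <= 2)%N by [].
apply: (Z_independent_leq (w := w) vi) => i.
have : span (ratr q, t) (v i).
  by rewrite -(affine_equiv_span zqt); apply: vz; exists i.
move=> /span_normal_form[a [b ->]].
exists (fun j : 'I_2 => nth 0 [:: a; b] j).
by rewrite !big_ord_recl big_ord0 /w /= addr0.
Qed.

Lemma rank1_affine_equiv z w : has_rank (span z) 1 -> span z = span w ->
  affine_equiv z w.
Proof.
move=> rk zw.
have nf v : span z = span v -> exists2 d : int, 0 < d & affine_equiv v (0, d%:~R^-1).
  move=> zv; rewrite zv in rk.
  have [a aE] := rank1_rational rk (span_coord1 v).
  have [b bE] := rank1_rational rk (span_coord2 v).
  by case: v zv rk aE bE => v1 v2 _ _ /= -> ->; exact: rational_affine_equiv.
have [d d0 zd] := nf z erefl; have [e e0 we] := nf w zw.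
have de : span (0, d%:~R^-1 : R) = span (0, e%:~R^-1).
  by rewrite -(affine_equiv_span zd) zw (affine_equiv_span we).
have le (a b : int) : 0 < a -> 0 < b ->
    span (0, a%:~R^-1 : R) = span (0, b%:~R^-1) -> a <= b.
  move=> a0 b0 ab; have : span (0, b%:~R^-1) (a%:~R^-1 : R).
    by rewrite -ab; exact: (span_coord2 (0, _)).
  have aR : 0 < a%:~R :> R by rewrite ltr0z.
  have bR : 0 < b%:~R :> R by rewrite ltr0z.
  case=> p; rewrite /affine_int /= mulr0 add0r => E.
  have : (b == a * (p.1.2 + p.2 * b)) .
    rewrite -(eqr_int R) intrM intrD intrM; apply/eqP.
    have: b%:~R * a%:~R * a%:~R^-1 = b%:~R * a%:~R * (p.1.2%:~R / b%:~R + p.2%:~R) :> R.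
      by rewrite E.
    by rewrite mulfK ?gt_eqF // => h; rewrite [LHS]h; field; rewrite gt_eqF.
  move=> /eqP; set k := p.1.2 + _ => bE; move: b0; rewrite bE pmulr_rgt0 // => k0.
  by rewrite -[leLHS]mulr1 ler_pM2l //; lia.
have E : d = e by apply/eqP; rewrite eq_le !le.
by rewrite -E in we; apply: (affine_equiv_trans zd); exact: affine_equiv_sym.
Qed.

(** A relation gives the normal form (q, t). If t were rational the group would
    be cyclic; being irrational, t is moved into the open unit interval by a
    translation. *)
Lemma rank2_normal_form z : has_rank (span z) 2 -> exists q t,
  [/\ irrational_R t, 0 < t < 1 & affine_equiv z (ratr q, t)].
Proof.
move=> rk; have [p pn pz] := rank2_relation rk.
have [q [t zqt]] := relation_affine_equiv pn pz.
have irr : irrational_R t.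
  move=> i j ij; apply/eqP; apply: contraT => j0.
  have jR : j%:~R != 0 :> R by rewrite intr_eq0.
  have dR := denq_neq0R R q.
  have [[v vz vi] _] := rk.
  pose w (_ : 'I_1) : R := ((denq q)%:~R * j%:~R)^-1.
  suff : (2 <= 1)%N by [].
  apply: (Z_independent_leq (w := w) vi) => l.
  have : span (ratr q, t) (v l).
    by rewrite -(affine_equiv_span zqt); apply: vz; exists l.
  move=> /span_normal_form[a [b ->]].
  exists (fun _ => a * j - b * i * denq q).
  rewrite big_ord1 /w intrB !intrM.
  have -> : t = - (i%:~R / j%:~R).
    by apply: (mulfI jR); rewrite mulrN mulrCA divff // mulr1; lra.
  by field; rewrite jR dR.
exists q, (t - (Num.floor t)%:~R); split.
- move=> i j; rewrite mulrBr addrCA addrC -intrM -intrB => h.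
  by apply: (irr (i - j * Num.floor t)); rewrite -[RHS]h intrB; ring.
- have /andP[f1 f2] := floor_itv t; rewrite intrD in f2.
  rewrite subr_gt0 ltrBlDl f2 andbT lt_neqAle f1 andbT.
  apply/eqP => ft; have := irr (- Num.floor t) 1.
  by rewrite mulrNz ft mul1r addNr => /(_ erefl) /eqP; rewrite oner_eq0.
- apply: affine_equiv_trans zqt _.
  have -> : (ratr q, t - (Num.floor t)%:~R) = (1%:~R * ratr q + 0%:~R * t + 0%:~R,
     0%:~R * ratr q + 1%:~R * t + (- Num.floor t)%:~R) :> R * R.
    by rewrite mulrNz; congr pair; ring.
  by apply: (@affine_equiv_unimodular _ _ _ _ _ _ _ 1); ring.
Qed.

Lemma span_least_pos_rat q (t : R) : irrational_R t ->
  least_pos_rat (span (ratr q, t)) (denq q)%:~R^-1.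
Proof.
move=> irr; have d0 : 0 < (denq q)%:~R :> rat by rewrite ltr0z denq_gt0.
split; first by rewrite invr_gt0.
  apply/span_normal_form; exists 1, 0.
  by rewrite mul0r addr0 fmorphV /= ratr_int mul1r.
move=> r r0 /span_normal_form[i [j rE]].
have dR := denq_neq0R R q; have rR := denq_neq0R R r.
have j0 : j * (denq q * denq r) = 0.
  apply: (irr (i * denq r - numq r * denq q)).
  rewrite intrB !intrM -ratrE rE; move: (divfK dR i%:~R).
  set x := i%:~R / _; move=> <-; ring.
have {}j0 : j = 0.
  by move/eqP: j0; rewrite !mulf_eq0 !(negPf (denq_neq0 _)) !orbF => /eqP.
have {}rE : r = i%:~R / (denq q)%:~R.
  apply: (fmorph_inj (@ratr R)).
  by rewrite /= rE j0 mul0r addr0 fmorph_div /= !ratr_int.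
rewrite rE -[leLHS]mul1r ler_pM2r ?invr_gt0 // ler1z.
move: r0; rewrite rE pmulr_lgt0 ?invr_gt0 // ltr0z; lia.
Qed.

Lemma least_pos_rat_uniq (A : set R) (a b : rat) :
  least_pos_rat A a -> least_pos_rat A b -> a = b.
Proof.
case=> a0 Aa amin [b0 Ab bmin]; apply/eqP; rewrite eq_le.
by rewrite amin // bmin.
Qed.

Lemma span_normal_form_denq q q' (t t' : R) : irrational_R t -> irrational_R t' ->
  span (ratr q, t) = span (ratr q', t') -> denq q = denq q'.
Proof.
move=> irr irr' E; have l' := span_least_pos_rat q' irr'.
have l := span_least_pos_rat q irr; rewrite E in l.
have /invr_inj := least_pos_rat_uniq l l'.
by move=> /eqP; rewrite eqr_int => /eqP.
Qed.

(** Expressing t and t' through each other forces t = j t' + i/d with j a unit;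
    the term i/d is realized by a shear because the numerator of q' is
    invertible modulo d. *)
Lemma normal_form_second q q' (t t' : R) : irrational_R t -> irrational_R t' ->
  span (ratr q, t) = span (ratr q', t') ->
  affine_equiv (ratr q', t') (ratr q', t).
Proof.
move=> irr irr' E; have dd := span_normal_form_denq irr irr' E.
have dR := denq_neq0R R q'.
have : span (ratr q', t') t by rewrite -E; exact: (span_coord2 (ratr q, t)).
move=> /span_normal_form[i [j tE]].
have : span (ratr q, t) t' by rewrite E; exact: (span_coord2 (ratr q', t')).
move=> /span_normal_form[i' [j' tE']].
have jj : j * j' - 1 = 0.
  have : (j * j' - 1) * denq q' = 0.
    apply: (irr (i + j * i')); rewrite !intrM intrB intrD !intrM.
    have e1 : (i%:~R : R) = i%:~R / (denq q')%:~R * (denq q')%:~R.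
      by rewrite divfK.
    have e2 : (i'%:~R : R) = i'%:~R / (denq q')%:~R * (denq q')%:~R.
      by rewrite divfK.
    rewrite e1 e2; move: tE tE'; rewrite dd.
    set x := i%:~R / _; set y := i'%:~R / _ => tE tE'.
    have -> : x = t - j%:~R * (y + j'%:~R * t) by rewrite -tE' {1}tE; ring.
    ring.
  by move/eqP; rewrite mulf_eq0 (negPf (denq_neq0 _)) orbF => /eqP.
have [s [u su]] := rat_bezout q'.
have j2 : j * j = 1.
  have : j \is a GRing.unit.
    apply/unitrP; exists j'; rewrite mulrC; move/eqP: jj.
    by rewrite subr_eq0 => /eqP ->.
  by rewrite qualifE /= => /orP[] /eqP ->.
have -> : (ratr q', t) = (1%:~R * ratr q' + 0%:~R * t' + 0%:~R,
   (i * s)%:~R * ratr q' + j%:~R * t' + (i * u)%:~R) :> R * R.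
  congr pair; first by ring.
  rewrite tE; apply: (mulIf dR); rewrite [LHS]mulrDl divfK // !intrM.
  transitivity (i%:~R * (s%:~R * (numq q')%:~R + u%:~R * (denq q')%:~R) +
    j%:~R * t' * (denq q')%:~R : R).
    by rewrite -!intrM -intrD su mulr1.
  by rewrite -ratrE; ring.
by apply: (@affine_equiv_unimodular _ _ _ _ _ _ _ j) => //; ring.
Qed.

Lemma normal_form_first q q' (t : R) k d : k * k = 1 -> denq q = denq q' ->
  numq q' - k * numq q = d * denq q' ->
  affine_equiv (ratr q, t) (ratr q', t).
Proof.
move=> kk dd nn; have dR := denq_neq0R R q'.
have -> : (ratr q', t) = (k%:~R * ratr q + 0%:~R * t + d%:~R,
   0%:~R * ratr q + 1%:~R * t + 0%:~R) :> R * R.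
  congr pair; last by ring.
  apply: (mulIf dR); rewrite ratrE !mulrDl -[k%:~R * _ * _]mulrA -{1}dd ratrE.
  rewrite -[d%:~R * _]intrM -nn intrB intrM; ring.
by apply: (@affine_equiv_unimodular _ _ _ _ _ _ _ k) => //; ring.
Qed.

Lemma normal_form_relation q (t : R) p : irrational_R t ->
  affine_int p (ratr q, t) = 0 ->
  exists k, p = scale_int k (denq q, 0, - numq q).
Proof.
case: p => -[a b] e irr; rewrite /affine_int /= => pz.
have b0 : b = 0.
  have : b * denq q = 0.
    apply: (irr (a * numq q + e * denq q)); rewrite intrD !intrM -ratrE.
    by rewrite -[RHS](mul0r (denq q)%:~R) -pz; ring.
  by move/eqP; rewrite mulf_eq0 (negPf (denq_neq0 _)) orbF => /eqP.
have ae : a * numq q + e * denq q = 0.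
  apply/eqP; rewrite -(eqr_int R) intrD !intrM -ratrE; apply/eqP.
  by rewrite -[RHS](mul0r (denq q)%:~R) -pz b0; ring.
have [s [u su]] := rat_bezout q.
exists (a * u - e * s); rewrite /scale_int /= b0 mulr0; congr (_, _, _).
- rewrite -[LHS]mulr1 -su.
  transitivity (a * u * denq q + s * (a * numq q + e * denq q) -
    s * e * denq q); first by ring.
  by rewrite ae; ring.
- transitivity (e * (s * numq q + u * denq q)); first by rewrite su mulr1.
  transitivity (u * (a * numq q + e * denq q) + e * s * numq q -
    a * u * numq q); first by ring.
  by rewrite ae; ring.
Qed.

End RankNormalForms.

(** * Counting the classes of germs *)

Section Counting.
Variable R : realType.

Lemma iso_classes_card (T : Type) (D : set T) (F : T -> ulgroupType) (N : nat)
    (g : 'I_N -> T) :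
  (forall i, D (g i)) ->
  (forall n, D n -> exists i, ul_iso (F (g i)) (F n)) ->
  (forall i j, ul_iso (F (g i)) (F (g j)) -> i = j) ->
  iso_classes D F #= `I_N.
Proof.
move=> Dg surj inj.
pose cl n : set T := [set j | D j /\ ul_iso (F n) (F j)].
have clE n n' : ul_iso (F n) (F n') -> cl n = cl n'.
  move=> nn'; apply/seteqP; split=> j [Dj h]; split=> //.
    exact: ul_iso_trans (ul_iso_sym nn') h.
  exact: ul_iso_trans nn' h.
have -> : iso_classes D F = [set cl (g i) | i in [set: 'I_N]].
  apply/seteqP; split=> _ [n Dn <-]; last by exists (g n).
  by have [i /clE gi] := surj n Dn; exists i.
apply: card_eq_trans (_ : [set: 'I_N] #= `I_N); last first.
  by rewrite card_eq_sym card_II.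
apply: inj_card_eq => i j _ _ /(congr1 (fun S : set T => S (g j))) ij.
apply: inj; have : cl (g j) (g j) by split=> //; exact: ul_iso_refl.
by rewrite -ij => -[].
Qed.

(** The symmetry c |-> d - c exchanges the residues below and above d/2, and for
    d > 2 the midpoint is not prime to d. *)
Lemma half_totient (d : nat) : (1 < d)%N ->
  #|[pred c : 'I_d.+1 | coprime d c && (c.*2 <= d)%N]| =
  maxn 1 (totient d %/ 2).
Proof.
move=> d1.
pose f c := (coprime d c && (c.*2 <= d)%N : nat).
pose g c := (coprime d c && (d < c.*2)%N : nat).
have -> : #|[pred c : 'I_d.+1 | coprime d c && (c.*2 <= d)%N]| =
    (\sum_(0 <= c < d.+1) f c)%N.
  rewrite -sum1_card big_mkcond /= big_mkord; apply: eq_bigr => i _.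
  by rewrite inE /f; case: ifP.
have [d2|dn2] := eqVneq d 2%N.
  rewrite d2 /f d2 !big_nat_recr //= big_geq //.
have fg : (\sum_(0 <= c < d.+1) g c = \sum_(0 <= c < d.+1) f c)%N.
  rewrite big_nat_rev /= add0n; apply: eq_big_nat => c /andP[_ cd].
  rewrite subSS /f /g; rewrite ltnS in cd.
  have -> : coprime d (d - c) = coprime d c.
    rewrite ![coprime d _]coprime_sym /coprime.
    have <- : gcdn (d - c) (d - c + c) = gcdn (d - c) d by rewrite subnK.
    have <- : gcdn c (d - c + c) = gcdn c d by rewrite subnK.
    by rewrite gcdnDl gcdnDr gcdnC.
  congr (nat_of_bool _); case: (boolP (coprime d c)) => //= cop.
  have : c.*2 != d.
    apply: contraTneq cop => cd2; rewrite -cd2 /coprime -muln2 gcdnC gcdnMr.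
    by apply: contra_neq dn2 => c1; rewrite -cd2 c1.
  lia.
have -> : totient d = (\sum_(0 <= c < d.+1) f c).*2.
  rewrite totient_count_coprime -addnn -{2}fg -big_split /=.
  have dd : coprime d d = false by rewrite /coprime gcdnn gtn_eqF.
  transitivity (\sum_(0 <= c < d.+1) coprime d c)%N.
    by rewrite big_nat_recr //= dd addn0.
  by apply: eq_bigr => c _; rewrite /f /g ltnNge; case: coprime; case: leq.
have : (0 < \sum_(0 <= c < d.+1) f c)%N.
  rewrite (bigD1_seq 1%N) ?mem_index_iota ?iota_uniq ?ltnS ?(ltnW d1) //=.
  by rewrite addn_gt0 {1}/f coprimen1 d1.
lia.
Qed.

End Counting.

Section NormalFormGerms.
Variable R : realType.
Implicit Types (x y : unit_square R) (m n : ideal (F2 R)) (q : rat) (t : R).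

Lemma nbhs_off_relation y q t : set_val y = (ratr q, t) -> ratr q < 1 :> R ->
  forall A, nbhs y A -> exists2 u, A u &
    affine_int (denq q, 0, - numq q) (set_val u) != 0.
Proof.
move=> yE q1 A /nbhs_box[e e0 eA].
pose a := Num.min e (1 - ratr q) / 2.
have m0 : 0 < Num.min e (1 - ratr q) by rewrite lt_min e0 subr_gt0.
have [a0 ae a1] : [/\ 0 < a, a < e & ratr q + a <= 1].
  have h1 : Num.min e (1 - ratr q) <= e by rewrite ge_min lexx.
  have h2 : Num.min e (1 - ratr q) <= 1 - ratr q by rewrite ge_min lexx orbT.
  by rewrite /a; split; lra.
have [/andP[y1 _] y2] := sq_bounds y; rewrite yE /= in y1 y2.
have hq : 0 <= ratr q + a <= 1 by rewrite a1 andbT addr_ge0 // ltW.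
exists (sqpt hq y2); first by
  apply: eA; rewrite sqptE yE /= ?subrr ?normr0 // addrAC subrr add0r gtr0_norm.
rewrite sqptE /affine_int /= mulrNz -ratrE mul0r addr0.
rewrite mulrDr [ratr q * _]mulrC addrAC subrr add0r.
by rewrite mulf_neq0 ?denq_neq0R // gt_eqF.
Qed.

(** At a point (q, t) the primitive relation is L = d X1 - c, with q = c/d, and
    L + c is divisible by d; so is, by transport, one of L' + c and - L' + c. *)
Lemma germinal_iso_numq x y m n q q' t t' :
  ideal_set m = ideal_at x -> ideal_set n = ideal_at y ->
  set_val x = (ratr q, t) -> set_val y = (ratr q', t') ->
  irrational_R t -> irrational_R t' -> ratr q' < 1 :> R -> denq q = denq q' ->
  ul_iso (quotient (germinal_ideal m)) (quotient (germinal_ideal n)) ->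
  exists2 k : int, k = 1 \/ k = -1 &
    exists e : int, numq q - k * numq q' = denq q * e.
Proof.
move=> mx ny xE yE irr irr' q1 dd iso.
have rel (v : unit_square R) r s : set_val v = (ratr r, s) ->
    affine_int (denq r, 0, - numq r) (set_val v) = 0.
  by move=> ->; rewrite /affine_int /= mulrNz -ratrE; ring.
have [p|p|k k1 kdiv] := germinal_iso_relation mx ny (rel _ _ _ xE)
    (rel _ _ _ yE) _ _ (nbhs_off_relation yE q1) iso.
- by rewrite xE; exact: normal_form_relation.
- by rewrite yE; exact: normal_form_relation.
exists k => //; have [|p] := kdiv (denq q) (numq q) (1, 0, 0).
  by rewrite /scale_int /= !mulr0 mulr1; congr (_, _, _); rewrite /= ?addr0 ?addNr.
case=> _ _ E; exists p.2; rewrite E /=; ring.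
Qed.

Lemma coprime_numq_modz q (k : int) (c : nat) : k = 1 \/ k = -1 ->
  (exists e : int, c%:Z - k * numq q = e * denq q) ->
  coprime `|denq q| c.
Proof.
move=> k1 [e cE]; have [s [u su]] := rat_bezout q.
suff : coprimez (denq q) c by [].
apply/coprimezP; exists (u - k * s * e, k * s) => /=.
have kk : k * k = 1 by case: k1 => ->.
transitivity (u * denq q + k * s * (c%:Z - e * denq q)); first by ring.
rewrite -cE opprB addrCA subrr addr0.
transitivity (u * denq q + k * k * (s * numq q)); first by ring.
by rewrite kk mul1r addrC.
Qed.

Lemma half_residue (a d : int) : 0 < d -> exists k : int, exists c : nat,
  [/\ k = 1 \/ k = -1, (c.*2 <= `|d|)%N & exists e : int, c%:Z - k * a = e * d].
Proof.
move=> d0; have dn : d != 0 by rewrite gt_eqF.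
have r0 := modz_ge0 a dn; have r1 := ltz_pmod a d0; have aE := divz_eq a d.
have [h|h] := leP ((a %% d)%Z * 2) d.
  exists 1, `|(a %% d)%Z|%N; split; [by left | lia |].
  exists (- (a %/ d)%Z); rewrite gez0_abs // mul1r {2}aE; ring.
exists (-1), `|d - (a %% d)%Z|%N; split; [by right | lia |].
exists (1 + (a %/ d)%Z); rewrite gez0_abs; last lia.
by rewrite mulN1r opprK {2}aE; ring.
Qed.

Lemma half_residue_inj (a b : nat) (d k e : int) :
  (0 < a)%N -> (a.*2 <= `|d|)%N -> (0 < b)%N -> (b.*2 <= `|d|)%N ->
  k = 1 \/ k = -1 -> a%:Z - k * b%:Z = d * e -> a = b.
Proof.
move=> a0 ad b0 bd kE eE.
(* a - k b has absolute value at most d, and equals d only for a = b = d/2 *)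
have [e0|en] : e = 0 \/ (`|d| <= `|(d * e)%R|)%N.
  have [->|en] := eqVneq e 0; first by left.
  by right; rewrite abszM leq_pmulr // absz_gt0.
  by move: eE; rewrite e0 mulr0; case: kE => ->; lia.
by move: en; rewrite -eE; case: kE => ->; lia.
Qed.

Lemma interior_in_interior m x : interior_pt (set_val x) ->
  ideal_set m = ideal_at x -> in_interior m.
Proof. by case=> x1 x2 mx; exists x. Qed.

(** The classes are represented by the points (c/d, t) with c prime to d and
    0 < 2c <= d. For d = 1 there is no such c, but then all numerators are
    congruent modulo d and every point in question is equivalent to x. *)
Lemma rank2_iso_classes m x : ideal_set m = ideal_at x ->
  interior_pt (set_val x) -> has_rank (span (set_val x)) 2 ->
  exists2 q : rat, least_pos_rat (span (set_val x)) q &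
    iso_classes
      [set n : ideal (F2 R) | [/\ maximal_ideal n, in_interior n &
                                  ul_iso (quotient n) (quotient m)]]
      (fun n => quotient (germinal_ideal n))
    #= `I_(maxn 1 (totient `|denq q|%N %/ 2)).
Proof.
move=> mx ix rk; have [q [t [irr t01 xqt]]] := rank2_normal_form rk.
have sx := affine_equiv_span xqt.
exists (denq q)%:~R^-1; first by rewrite sx; exact: span_least_pos_rat.
have d0 : 0 < denq q := denq_gt0 q.
rewrite denqVz ?gt_eqF // absz_id; set D := [set n | _].
(* the second coordinate can be taken to be the same t for all the points *)
have other n : D n -> exists y q', [/\ ideal_set n = ideal_at y,
    interior_pt (set_val y), denq q' = denq q &
    affine_equiv (set_val y) (ratr q', t)].
  case=> maxn [y [y1 y2 ny]] nm; exists y.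
  have yx : span (set_val y) = span (set_val x) by apply/(quotient_isoP ny mx).
  have [q' [t' [irr' _ yq']]] : exists q t, [/\ irrational_R t, 0 < t < 1 &
      affine_equiv (set_val y) (ratr q, t)].
    by apply: rank2_normal_form; rewrite yx.
  have qq' : span (ratr q, t) = span (ratr q', t').
    by rewrite -sx -yx; exact: affine_equiv_span.
  exists q'; split=> //; first by rewrite (span_normal_form_denq irr irr' qq').
  exact: affine_equiv_trans yq' (normal_form_second irr irr' qq').
have [d1|d1] : denq q = 1 \/ (1 < `|denq q|)%N by lia.
  rewrite d1; have -> : maxn 1 (totient `|1%Z| %/ 2) = 1%N by [].
  have Dm : D m.
    split; [exact: ideal_at_maximal mx | exact: interior_in_interior ix mx |].
    exact: ul_iso_refl.
  apply: (iso_classes_card (g := fun _ : 'I_1 => m)) => //; last first.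
    by move=> i j _; rewrite !ord1.
  move=> n /other[y [q' [ny iy dq' yq']]]; exists ord0.
  apply: (affine_equiv_germinal_iso mx ny ix iy).
  apply: (affine_equiv_trans xqt); apply: affine_equiv_sym.
  apply: (affine_equiv_trans yq').
  apply: (@normal_form_first _ _ _ _ 1 (numq q - numq q')) => //.
  by rewrite d1; ring.
have dR : (denq q)%:~R != 0 :> R := denq_neq0R R q.
pose A := [pred c : 'I_(`|denq q|).+1 |
  coprime `|denq q| c && (c.*2 <= `|denq q|)%N].
pose qc (c : nat) : rat := c%:~R / (denq q)%:~R.
have qcE c : ratr (qc c) = c%:~R / (denq q)%:~R :> R.
  by rewrite fmorph_div /= !ratr_int.
have qc_num c : coprime `|denq q| c -> numq (qc c) = c.
  by move=> cc; rewrite coprimeq_num 1?coprime_sym // gtr0_sg // mul1r.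
have qc_den c : coprime `|denq q| c -> denq (qc c) = denq q.
  move=> cc; rewrite coprimeq_den 1?coprime_sym // gt_eqF //.
  by rewrite gtr0_norm.
have dR0 : 0 < (denq q)%:~R :> R by rewrite ltr0z.
have qc01 c : coprime `|denq q| c -> (c.*2 <= `|denq q|)%N ->
    0 < (ratr (qc c) : R) < 1.
  move=> cc c2; have c0 : (0 < c)%N.
    by case: c cc {c2} => //; rewrite /coprime gcdn0 gtn_eqF.
  rewrite qcE divr_gt0 ?ltr0z //= ltr_pdivrMr // mul1r ltr_int; lia.
have t01' : 0 <= t <= 1 by case/andP: t01 => h1 h2; rewrite !ltW.
have pt_ex (i : 'I_#|A|) : exists y, set_val y = (ratr (qc (enum_val i)), t).
  have := enum_valP i; rewrite inE => /andP[cc c2].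
  have /andP[h1 h2] := qc01 _ cc c2.
  have h : 0 <= (ratr (qc (enum_val i)) : R) <= 1 by rewrite !ltW.
  by exists (sqpt h t01').
pose pt i := projT1 (cid (pt_ex i)).
have ptE i : set_val (pt i) = (ratr (qc (enum_val i)), t) := projT2 (cid (pt_ex i)).
have pt_int i : interior_pt (set_val (pt i)).
  have := enum_valP i; rewrite inE => /andP[cc c2].
  by rewrite ptE; split=> //; exact: qc01.
rewrite -half_totient //.
apply: (iso_classes_card (g := fun i => maxid (pt i))).
- move=> i; split; first exact: (ideal_at_maximal (x := pt i)).
    exact: (interior_in_interior (pt_int i)).
  apply/(quotient_isoP (y := x) (maxidE (pt i)) mx); rewrite sx ptE.
  have := enum_valP i; rewrite inE => /andP[cc c2].
  apply/seteqP; split=> r /span_normal_form[a [b ->]]; apply/span_normal_form;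
    by exists a, b; rewrite qc_den.
- move=> n /other[y [q' [ny iy dq' yq']]].
  have [k [c [k1 c2 ec]]] := half_residue (numq q') d0.
  have cc : coprime `|denq q| c.
    by rewrite -dq'; apply: (coprime_numq_modz k1); rewrite dq'.
  have cd : (c < `|denq q|.+1)%N by lia.
  have cA : Ordinal cd \in A by rewrite inE /= cc.
  exists (enum_rank_in cA (Ordinal cd)).
  apply: (affine_equiv_germinal_iso (maxidE _) ny (pt_int _) iy).
  apply: affine_equiv_sym; apply: (affine_equiv_trans yq').
  rewrite ptE enum_rankK_in //=; case: ec => e eE.
  apply: (@normal_form_first _ _ _ _ k e).
  + by case: k1 => ->.
  + by rewrite qc_den.
  + by rewrite qc_num // qc_den.
- move=> i j ij; apply: enum_val_inj; apply: val_inj => /=.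
  have := enum_valP i; rewrite inE => /andP[ci ci2].
  have := enum_valP j; rewrite inE => /andP[cj cj2].
  have /andP[_ j1] := qc01 _ cj cj2.
  have := germinal_iso_numq (maxidE _) (maxidE _) (ptE i) (ptE j) irr irr j1.
  rewrite !qc_den // !qc_num // => /(_ erefl ij).
  have c0 (c : nat) : coprime `|denq q| c -> (0 < c)%N.
    by case: c => //; rewrite /coprime gcdn0 gtn_eqF.
  have := c0 _ ci; have := c0 _ cj.
  move=> cj0 ci0 [k k1 [e eE]]; apply: (half_residue_inj ci0 ci2 cj0 cj2 k1 eE).
Qed.

End NormalFormGerms.

Theorem theorem7p1 (R : realType) (m : ideal (F2 R))
    (max_m : maximal_ideal m) (int_m : in_interior m) :
  (* (i) *)
  [/\ zmod_closed (mem (holder_group (R := R) m)),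
      holder_group (R := R) m 1 &
      exists2 r : nat, (r <= 3)%N & has_rank (holder_group (R := R) m) r]
  (* (ii) *)
  /\ (has_rank (holder_group (R := R) m) 3 ->
      forall n : ideal (F2 R), maximal_ideal n ->
        (ul_iso (quotient m) (quotient n) <->
         ul_iso (quotient (germinal_ideal m)) (quotient (germinal_ideal n))))
  /\ (has_rank (holder_group (R := R) m) 1 ->
      forall n : ideal (F2 R), maximal_ideal n -> in_interior n ->
        (ul_iso (quotient m) (quotient n) <->
         ul_iso (quotient (germinal_ideal m)) (quotient (germinal_ideal n))))
  (* (iii) *)
  /\ (has_rank (holder_group (R := R) m) 2 ->
      exists2 q : rat, least_pos_rat (holder_group (R := R) m) q &
        iso_classes
          [set n : ideal (F2 R) | [/\ maximal_ideal n, in_interior n &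
                                      ul_iso (quotient n) (quotient m)]]
          (fun n => quotient (germinal_ideal n))
        #= `I_(maxn 1 (totient `|denq q|%N %/ 2))).
Proof.
have [x [x1 x2 mx]] := int_m; have ix : interior_pt (set_val x) by split.
rewrite (holder_groupE mx); split; last split; last split.
- split; [exact: span_zmod | exact: span1 | exact: span_has_rank].
- move=> rk n max_n; have [y ny] := maximal_ideal_at max_n.
  have rx := rank3_no_relation rk.
  split=> [mn|]; last by move/(germinal_iso_span mx ny)/(quotient_isoP mx ny).
  have yx : span (set_val x) = span (set_val y) by apply/(quotient_isoP mx ny).
  rewrite yx in rk; have ry := rank3_no_relation rk.
  by rewrite (germinal_ideal_no_relation mx rx) (germinal_ideal_no_relation ny ry).
- move=> rk n max_n [y [y1 y2 ny]]; have iy : interior_pt (set_val y) by split.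
  split=> [mn|]; last by move/(germinal_iso_span mx ny)/(quotient_isoP mx ny).
  apply: (affine_equiv_germinal_iso mx ny ix iy).
  by apply: rank1_affine_equiv rk _; apply/(quotient_isoP mx ny).
- exact: rank2_iso_classes mx ix.
Qed.
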